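(* Let $\mathcal{E}_1$ be the set of $\nu\in\mathcal{E}$ such that for every $i\in\mathcal{TS}(\nu)$ with $\mathbf{Br}_\nu(i)>i$ one has $\nu_i+\nu_{i+1}\succ \nu_{\mathbf{Br}_\nu(i)}+\frac{\mathbf{Br}_\nu(i)-i}{2}$. For every non-negative integer $m$ and every commutative monomial $C$ in $a_1,\ldots,a_n$, let $U(C,m)$ be the number of $\lambda\in\mathcal{O}$ with $(C(\lambda),|\lambda|)=(C,m)$ and $W(C,m)$ the number of $\nu\in\mathcal{E}_1$ with $(C(\nu),|\nu|)=(C,m)$. Then $U(C,m)=W(C,m)$, and as formal power series $$\sum_{m,u_1,\ldots,u_n\ge 0}W\Big(\prod_{i=1}^n a_i^{u_i},m\Big)\prod_{i=1}^n a_i^{u_i}q^m=\sum_{m,u_1,\ldots,u_n\ge 0}U\Big(\prod_{i=1}^n a_i^{u_i},m\Big)\prod_{i=1}^n a_i^{u_i}q^m=\prod_{i=1}^n(-a_iq;q)_\infty,$$ where $(x;q)_\infty=\prod_{k\ge0}(1-xq^k)$.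
   Context: Primary colors $a_1<\cdots<a_n$ ($n\ge1$); secondary colors $a_ia_j$, $1\le i<j\le n$. Total order on colors: $a_1a_2<\cdots<a_1a_n<a_1<a_2a_3<\cdots<a_2a_n<a_2<\cdots<a_{n-1}a_n<a_{n-1}<a_n$. A colored part $k_p$ has integer size $k$ and color $p$; for an integer $m$, $k_p+m=(k+m)_p$. $k_p\succ l_q$ means $k-l\ge\chi(p\le q)$ ($\chi$ the indicator), $k_p\succeq l_q$ means $k_p\succ l_q$ or equality. A pair $(a_ka_l,a_ia_j)$ of secondary colors is special if $i<j<k<l$ or $k<i<j<l$. $\mathcal{P}$: parts with primary color and positive size; $\mathcal{S}$: parts with secondary color and size $\ge2$. For $k_p,l_q\in\mathcal{P}\sqcup\mathcal{S}$: $k_p\triangleright l_q$ iff $k_p\succeq(l+1)_q$ when $p$ or $q$ is primary, and $k_p\succ(l+1)_q$ when both are secondary. $k_p\gg l_q$ iff $k_p\succeq(l+1)_q$ when $p$ or $q$ is primary; $k_p\succ(l+1)_q$ when both are secondary and $(p,q)$ not special; $k_p\succ l_q$ when $(p,q)$ is special. $\mathcal{O}$: finite sequences $\lambda_1\succ\cdots\succ\lambda_t$ of parts in $\mathcal{P}$; $\mathcal{E}$: finite sequences $\nu_1\gg\cdots\gg\nu_t$ of parts in $\mathcal{P}\sqcup\mathcal{S}$. Size = sum of sizes; $C(\cdot)$ = commutative product of colors, $a_ia_j$ counted as $a_i\cdot a_j$. Halves: for $1\le i<j\le n$ and $k\ge0$, $\alpha((2k)_{a_ia_j})=k_{a_j}$,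 $\beta((2k)_{a_ia_j})=k_{a_i}$, $\alpha((2k+1)_{a_ia_j})=(k+1)_{a_i}$, $\beta((2k+1)_{a_ia_j})=k_{a_j}$ (upper and lower halves). Expanded indexing: if $\nu\in\mathcal{E}$ has $p$ primary and $s$ secondary parts, write $\nu=(\nu_1,\ldots,\nu_{p+2s})$ by replacing each secondary part, in place, by the two primary parts $\alpha$ (its upper half) followed by $\beta$ (its lower half). $J$ is the set of indices of original primary parts and $I$ the set of indices of upper halves; for $i\in I$, $\nu_i+\nu_{i+1}$ denotes the original secondary part with halves $\nu_i,\nu_{i+1}$. Set $\nu_{p+2s+1}=0_{a_n}$. Bridge: for $i\in I$ let $j=\min\big((i,p+2s+1]\cap(J\cup\{p+2s+1\})\big)$. If $\nu_{i'+1}\not\succ \nu_j+\frac{j-i'}{2}-1$ for all $i'\in[i,j)\cap I$, set $\mathbf{Br}_\nu(i)=j$. Otherwise let $\mathcal{S}_i=\{u\in(i,j)\cap I:\ \nu_{i'+1}\not\succ\nu_u+\frac{u-i'}{2}-1\ \forall i'\in[i,u)\cap I\}$ and set $\mathbf{Br}_\nu(i)=\max\mathcal{S}_i$ if $\mathcal{S}_i\ne\emptyset$, and $\mathbf{Br}_\nu(i)=i$ otherwise. $\mathcal{TS}(\nu)$ is the set of $i\in I$ such that the part immediately after the secondary part $\nu_i+\nu_{i+1}$ is a secondary part $\nu_{i+2}+\nu_{i+3}$ with $\nu_i+\nu_{i+1}\not\triangleright\,\nu_{i+2}+\nu_{i+3}$, and such that the part $\nu^-(i)$ immediately to the left of $\nu_i+\nu_{i+1}$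 (in the original, non-expanded sequence) satisfies $\nu^-(i)\triangleright\nu_i+\nu_{i+1}$, this last condition being regarded as satisfied if $\nu_i+\nu_{i+1}$ is the first part of $\nu$. *)

(* Defs.v *)
From HB Require Import structures.
From mathcomp Require Import all_boot all_order all_algebra finmap.
From mathcomp Require Import boolp classical_sets functions cardinality.

Set Implicit Arguments.
Unset Strict Implicit.
Unset Printing Implicit Defensive.

Import Order.TTheory GRing.Theory Num.Theory.

Local Open Scope classical_set_scope.
Local Open Scope ring_scope.

(* The primary colors a_1 < ... < a_n are the elements 0, ..., n-1 of 'I_n;
   the secondary color a_i a_j is the pair (i, j). *)
Definition secondary (n : nat) := {ij : 'I_n * 'I_n | (ij.1 < ij.2)%N}.

Definition color (n : nat) : Type := ('I_n + secondary n)%type.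

Definition is_primary (n : nat) (p : color n) : bool :=
  if p is inl _ then true else false.

Definition is_secondary (n : nat) (p : color n) : bool := ~~ is_primary p.

(* The order a_1a_2 < ... < a_1a_n < a_1 < a_2a_3 < ... < a_2a_n < a_2 < ...
   is lexicographic once a_i is read as (i, infinity); with indices below n,
   the value n serves as infinity. *)
Definition color_key (n : nat) (p : color n) : nat * nat :=
  match p with
  | inl i => (nat_of_ord i, n)
  | inr ij => (nat_of_ord (val ij).1, nat_of_ord (val ij).2)
  end.

Definition color_le (n : nat) (p q : color n) : bool :=
  let: (i, j) := color_key p in let: (k, l) := color_key q in
  (i < k)%N || ((i == k) && (j <= l)%N).

Definition special (n : nat) (p q : color n) : bool :=
  match p, q with
  | inr kl, inr ij =>
      let: (k, l) := val kl in let: (i, j) := val ij in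
      [&& i < j, j < k & k < l]%N || [&& k < i, i < j & j < l]%N
  | _, _ => false
  end.

Definition part (n : nat) : Type := (int * color n)%type.

Section Parts.
Variable n : nat.
Implicit Types x y : part n.

Definition shift x (m : int) : part n := (x.1 + m, x.2).

Definition succ x y : bool := (color_le x.2 y.2 : nat)%:Z <= x.1 - y.1.

Definition succeq x y : bool := succ x y || (x == y).

Definition triangle x y : bool :=
  if is_primary x.2 || is_primary y.2 then succeq x (shift y 1)
  else succ x (shift y 1).

Definition gg x y : bool :=
  if is_primary x.2 || is_primary y.2 then succeq x (shift y 1)
  else if special x.2 y.2 then succ x y
  else succ x (shift y 1).

Definition in_P x : bool := is_primary x.2 && (0 < x.1).
Definition in_S x : bool := is_secondary x.2 && (2 <= x.1).

Definition in_O (s : seq (part n)) : bool := all in_P s && sorted succ s.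

Definition in_E (s : seq (part n)) : bool :=
  all [pred x | in_P x || in_S x] s && sorted gg s.

Definition weight (s : seq (part n)) : int := \sum_(x <- s) x.1.

(* A commutative monomial in a_1, ..., a_n is its exponent vector. *)
Definition color_monomial (p : color n) : {ffun 'I_n -> nat} :=
  match p with
  | inl i => [ffun k => (k == i : nat)]
  | inr ij => [ffun k => ((k == (val ij).1) + (k == (val ij).2))%N]
  end.

Definition monomial (s : seq (part n)) : {ffun 'I_n -> nat} :=
  \sum_(x <- s) color_monomial x.2.

Definition upper_half (k : int) (ij : secondary n) : part n :=
  if (k %% 2)%Z == 0 then ((k %/ 2)%Z, inl (val ij).2)
  else ((k %/ 2)%Z + 1, inl (val ij).1).

Definition lower_half (k : int) (ij : secondary n) : part n :=
  if (k %% 2)%Z == 0 then ((k %/ 2)%Z, inl (val ij).1)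
  else ((k %/ 2)%Z, inl (val ij).2).

Definition halves x : seq (part n) :=
  match x.2 with
  | inl _ => [:: x]
  | inr ij => [:: upper_half x.1 ij; lower_half x.1 ij]
  end.

Definition blocks (nu : seq (part n)) : seq (seq (part n)) := map halves nu.
Definition expand (nu : seq (part n)) : seq (part n) := flatten (blocks nu).

(* For an index i of the expanded sequence, the position in nu of the part
   that the i-th expanded term comes from. *)
Definition origin (nu : seq (part n)) (i : nat) : nat :=
  reshape_index (shape (blocks nu)) i.

End Parts.

(* There are n.+1 >= 1 primary colors from here on, so that the largest one
   exists.  Indices of the expanded sequence start from 0 instead of 1: the
   terms are numbered 0, ..., p+2s-1 and the conventional extra term 0_{a_n}
   has index p+2s.  Only differences of indices occur in the definitions
   below. *)
Section Expanded.
Variables (n : nat) (nu : seq (part n.+1)).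

Definition last_part : part n.+1 := (0, inl ord_max).

Definition elen : nat := size (expand nu).

Definition eterm (i : nat) : part n.+1 := nth last_part (expand nu) i.

(* For i an index of an upper half, opart i is the secondary part written
   nu_i + nu_{i+1} in the expanded indexing. *)
Definition opart (i : nat) : part n.+1 := nth last_part nu (origin nu i).

Definition in_J (i : nat) : bool := (i < elen)%N && is_primary (opart i).2.

Definition in_I (i : nat) : bool :=
  [&& (i < elen)%N, is_secondary (opart i).2 &
      reshape_offset (shape (blocks nu)) i == 0%N].

(* The condition on u tested in the definition of the bridge of i.  Between
   the indices i' and u there are only halves of secondary parts whenever it
   is used, so u - i' is even. *)
Definition bridge_cond (i u : nat) : bool :=
  all (fun i' => ~~ succ (eterm i'.+1)
                         (shift (eterm u) ((u - i')./2%:Z - 1)))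
      [seq i' <- index_iota i u | in_I i'].

Definition next_J (i : nat) : nat :=
  \big[minn/elen]_(u <- index_iota i.+1 elen.+1 | in_J u || (u == elen)) u.

Definition bridge_set (i : nat) : seq nat :=
  [seq u <- index_iota i.+1 (next_J i) | in_I u && bridge_cond i u].

Definition Br (i : nat) : nat :=
  if bridge_cond i (next_J i) then next_J i
  else if bridge_set i is [::] then i
  else (\max_(u <- bridge_set i) u)%N.

Definition in_TS (i : nat) : bool :=
  [&& in_I i, in_I i.+2, ~~ triangle (opart i) (opart i.+2) &
      (origin nu i == 0%N)
      || triangle (nth last_part nu (origin nu i).-1) (opart i)].

End Expanded.

Definition in_E1 (n : nat) (nu : seq (part n.+1)) : Prop :=
  in_E nu /\
  forall i : nat, in_TS nu i -> (i < Br nu i)%N ->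
    succ (opart nu i) (shift (eterm nu (Br nu i)) (Br nu i - i)./2%:Z).

Definition O_set (n : nat) (C : {ffun 'I_n.+1 -> nat}) (m : nat) :
    set (seq (part n.+1)) :=
  [set s | in_O s /\ (monomial s, weight s) = (C, m%:Z)].

Definition E1_set (n : nat) (C : {ffun 'I_n.+1 -> nat}) (m : nat) :
    set (seq (part n.+1)) :=
  [set s | in_E1 s /\ (monomial s, weight s) = (C, m%:Z)].

(* fset_set is only meaningful on finite sets; finite_O_set and finite_E1_set
   below show that it is applied to finite sets here. *)
Definition U (n : nat) (C : {ffun 'I_n.+1 -> nat}) (m : nat) : nat :=
  #|` fset_set (O_set C m)|%fset.

Definition W (n : nat) (C : {ffun 'I_n.+1 -> nat}) (m : nat) : nat :=
  #|` fset_set (E1_set C m)|%fset.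

Section Finiteness.
Variable n : nat.

Let letter (m : nat) (a : 'I_m.+1 * color n.+1) : part n.+1 :=
  ((a.1 : nat)%:Z, a.2).

Lemma bounded_seq (m : nat) (s : seq (part n.+1)) :
  all (fun x => 0 < x.1) s -> weight s <= m%:Z ->
  exists t : m.-bseq ('I_m.+1 * color n.+1), s = map (@letter m) t.
Proof.
move=> s_gt0 s_le.
have [szs les] : (size s)%:Z <= weight s /\ {in s, forall x, x.1 <= weight s}.
  elim: s s_gt0 {s_le} => [|x s IHs] /=; first by rewrite /weight big_nil.
  case/andP=> x_gt0 /IHs[szs les]; rewrite /weight big_cons -/(weight s).
  have w_ge0 : 0 <= weight s by apply: le_trans szs.
  split; first by rewrite -addn1 PoszD addrC lerD // -gtz0_ge1.
  move=> y; rewrite inE => /predU1P[-> | /les le_y]; first by rewrite lerDl.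
  by apply: le_trans le_y _; rewrite lerDr ltW.
pose f (x : part n.+1) : 'I_m.+1 * color n.+1 := (inord `|x.1|%N, x.2).
have szt : (size (map f s) <= m)%N.
  by rewrite size_map -lez_nat (le_trans szs).
exists (Bseq szt); rewrite /= -map_comp map_id_in // => -[k p] sx.
have k_gt0 : 0 < k := allP s_gt0 _ sx.
have := le_trans (les _ sx) s_le; rewrite /letter /f /=.
case: k k_gt0 {sx} => // k _ le_km.
by rewrite inordK // ltnS -lez_nat.
Qed.

Lemma finite_weight (m : nat) (A : set (seq (part n.+1))) :
  (forall s, A s -> all (fun x => 0 < x.1) s /\ weight s = m%:Z) ->
  finite_set A.
Proof.
move=> Am; pose T : finType := m.-bseq ('I_m.+1 * color n.+1).
have finT : finite_set [set: T] by exact: finite_finset.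
apply: (sub_finite_set _ (finite_image (fun t : T => map (@letter m) t) finT)).
move=> s /Am[s_gt0 ws]; have [|t ->] := @bounded_seq m s s_gt0.
  by rewrite ws.
by exists t.
Qed.

Lemma finite_O_set (C : {ffun 'I_n.+1 -> nat}) (m : nat) :
  finite_set (O_set C m).
Proof.
apply: (@finite_weight m) => s [/andP[sP _] [_ ->]]; split=> //.
by apply: sub_all sP => x /andP[].
Qed.

Lemma finite_E1_set (C : {ffun 'I_n.+1 -> nat}) (m : nat) :
  finite_set (E1_set C m).
Proof.
apply: (@finite_weight m) => s [[/andP[sE _] _] [_ ->]]; split=> //.
apply: sub_all sE => x /orP[] /andP[_] //.
exact: lt_le_trans.
Qed.

End Finiteness.

(* Formal power series over int in the variables indexed by the finite type
   I: a series is the function mapping an exponent vector to its coefficient. *)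
Definition fps (I : finType) : Type := {ffun I -> nat} -> int.

Section FormalPowerSeries.
Variable I : finType.
Implicit Types (e d : {ffun I -> nat}) (f g h : fps I).

HB.instance Definition _ := GRing.Zmodule.copy (fps I) ({ffun I -> nat} -> int).

Definition below e : seq {ffun I -> nat} :=
  [seq [ffun i => d i : nat] | d : {dffun forall i : I, 'I_(e i).+1}].

Definition esub e d : {ffun I -> nat} := [ffun i => (e i - d i)%N].

Definition fps_one : fps I := fun e => (e == 0)%:R.

Definition fps_mul f g : fps I :=
  fun e => \sum_(d <- below e) f d * g (esub e d).

Lemma mem_below e d : (d \in below e) = [forall i, d i <= e i]%N.
Proof.
apply/mapP/forallP => [[c _ ->] i | le_de]; first by rewrite ffunE -ltnS.
exists [ffun i => Ordinal (le_de i : d i < (e i).+1)%N].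
  by rewrite mem_enum.
by apply/ffunP=> i; rewrite !ffunE.
Qed.

Lemma below_uniq e : uniq (below e).
Proof.
rewrite map_inj_uniq ?enum_uniq // => c d /ffunP eq_cd; apply/ffunP=> i.
by apply/val_inj; have := eq_cd i; rewrite !ffunE.
Qed.

Lemma below0 e : 0 \in below e.
Proof. by rewrite mem_below; apply/forallP=> i; rewrite ffunE. Qed.

Lemma fps_mulC : commutative fps_mul.
Proof.
move=> f g; apply/funext=> e; rewrite /fps_mul.
have le_sub d : esub e d \in below e.
  by rewrite mem_below; apply/forallP=> i; rewrite ffunE leq_subr.
have subK : {in below e, involutive (esub e)}.
  move=> d; rewrite mem_below => /forallP le_de; apply/ffunP=> i.
  by rewrite !ffunE subKn.
have perm_sub : perm_eq (map (esub e) (below e)) (below e).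
  apply: uniq_perm; rewrite ?below_uniq //.
    by rewrite map_inj_in_uniq ?below_uniq //; apply: can_in_inj subK.
  move=> d; apply/mapP/idP => [[c _ ->] // | d_e].
  by exists (esub e d); rewrite ?subK.
rewrite -(perm_big _ perm_sub) big_map big_seq [RHS]big_seq.
by apply: eq_bigr => d d_e; rewrite subK // mulrC.
Qed.

Lemma fps_mul1 : left_id fps_one fps_mul.
Proof.
move=> f; apply/funext=> e.
rewrite /fps_mul (bigD1_seq 0) ?below0 ?below_uniq //= big1 => [|d d_neq0].
  rewrite /fps_one eqxx mul1r addr0; congr f.
  by apply/ffunP=> i; rewrite !ffunE subn0.
by rewrite /fps_one (negPf d_neq0) mul0r.
Qed.

Lemma fps_mulDl : left_distributive fps_mul +%R.
Proof.
move=> f g h; apply/funext=> e.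
rewrite [RHS](_ : _ = fps_mul f h e + fps_mul g h e) //.
by rewrite /fps_mul -big_split; apply: eq_bigr => d _; rewrite /= -mulrDl.
Qed.

Lemma fps_mulA : associative fps_mul.
Proof.
move=> f g h; apply/funext=> e; rewrite /fps_mul.
under eq_bigr do rewrite mulr_sumr.
under [RHS]eq_bigr do rewrite mulr_suml.
pose s1 := [seq (c, b) | c <- below e, b <- below (esub e c)].
pose s2 := [seq (d, c) | d <- below e, c <- below d].
pose F (z : {ffun I -> nat} * {ffun I -> nat}) :=
  f z.2 * g (esub z.1 z.2) * h (esub e z.1).
pose phi (z : {ffun I -> nat} * {ffun I -> nat}) := (z.1 + z.2, z.1).
have uniq_dep (u : {ffun I -> nat} -> {ffun I -> nat}) :
    uniq [seq (c, b) | c <- below e, b <- below (u c)].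
  apply: allpairs_uniq_dep => [|c _|[? ?] [? ?] _ _ [-> ->]] //;
  exact: below_uniq.
have perm_s : perm_eq (map phi s1) s2.
  apply: uniq_perm; last 1 first.
  - move=> [d c]; apply/mapP/allpairsPdep => [[[c' b] /allpairsPdep] | ].
      move=> [c1 [b1 [c1e b1e [-> ->]]]] [-> ->]; exists (c1 + b1), c1.
      split=> //; rewrite mem_below; apply/forallP=> i; rewrite !ffunE.
        move: c1e b1e; rewrite !mem_below => /forallP/(_ i) le1 /forallP/(_ i).
        by rewrite ffunE leq_subRL.
      exact: leq_addr.
    move=> [d1 [c1 [d1e c1d [-> ->]]]]; move: d1e c1d.
    rewrite !mem_below => /forallP le_de /forallP le_cd.
    exists (c1, esub d1 c1); last first.
      by congr pair; apply/ffunP=> i; rewrite !ffunE [RHS]subnKC.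
    apply/allpairsPdep; exists c1, (esub d1 c1); split=> //.
      by rewrite mem_below; apply/forallP=> i; apply: leq_trans (le_de i).
    by rewrite mem_below; apply/forallP=> i; rewrite !ffunE leq_sub2r.
  - rewrite map_inj_uniq ?uniq_dep // => -[c b] [c' b'] [] /[swap] <-.
    move/ffunP=> eq_cb; congr pair; apply/ffunP=> i.
    by have := eq_cb i; rewrite !ffunE => /addnI.
  - exact: (uniq_dep id).
have -> : \sum_(d <- below e) \sum_(c <- below d)
      f c * g (esub d c) * h (esub e d) = \sum_(z <- s2) F z.
  by rewrite big_allpairs_dep.
rewrite -(perm_big _ perm_s) [RHS]big_map [RHS]big_allpairs_dep /=.
apply: eq_bigr => c _; apply: eq_bigr => b _; rewrite /F /= -mulrA.
by congr (_ * (g _ * h _)); apply/ffunP=> i; rewrite !ffunE ?addKn ?subnDA.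
Qed.

Lemma fps_one_neq0 : fps_one != 0.
Proof.
by apply/eqP => /(congr1 (fun f : fps I => f 0)); rewrite /fps_one eqxx.
Qed.

HB.instance Definition _ := GRing.Zmodule_isComNzRing.Build (fps I)
  fps_mulA fps_mulC fps_mul1 fps_mulDl fps_one_neq0.

Definition fps_var (v : I) : fps I := fun e => (e == [ffun w => (w == v : nat)])%:R.

(* Coefficientwise limit: the coefficient of the limit at e is the eventual
   value of the coefficients at e (and 0 if there is none). *)
Definition fps_lim (s : nat -> fps I) : fps I :=
  fun e => xget 0 [set c | exists K, forall k, (K <= k)%N -> s k e = c].

(* (x; q)_oo *)
Definition qpoch_infty (x q : fps I) : fps I :=
  fps_lim (fun K => \prod_(k < K) (1 - x * q ^+ k)).

Lemma fps_mulXn_coef0 (v : I) f k e :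
  (e v < k)%N -> (f * fps_var v ^+ k) e = 0.
Proof.
elim: k e => // k IHk e; rewrite ltnS exprSr mulrA => le_ek.
rewrite [LHS]big_seq big1 // => d; rewrite mem_below => /forallP/(_ v) le_de.
rewrite {2}/fps_var; case: eqP => [/ffunP/(_ v) | _]; last by rewrite mulr0.
rewrite !ffunE eqxx => ed1; rewrite IHk ?mul0r //.
by rewrite (leq_trans _ le_ek) // -subn_gt0 ed1.
Qed.

(* The limit defining (x; q)_oo exists whenever q is one of the variables. *)
Lemma qpoch_infty_cvg (x : fps I) (v : I) e :
  exists K, forall k, (K <= k)%N ->
    (\prod_(i < k) (1 - x * fps_var v ^+ i)) e = qpoch_infty x (fps_var v) e.
Proof.
pose s k : fps I := \prod_(i < k) (1 - x * fps_var v ^+ i).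
have sS k : (e v < k)%N -> s k.+1 e = s k e.
  move=> lt_ek; rewrite /s big_ord_recr /= mulrBr mulr1 mulrA.
  set p := \prod_(i < k) _.
  rewrite [LHS](_ : _ = p e - (p * x * fps_var v ^+ k) e) //.
  by rewrite fps_mulXn_coef0 // subr0.
have s_cst k : (e v < k)%N -> s k e = s (e v).+1 e.
  elim: k => // k IHk; rewrite ltnS leq_eqVlt => /predU1P[<- // | lt_ek].
  by rewrite sS // IHk.
have [K sK] : exists K, forall k, (K <= k)%N ->
    s k e = qpoch_infty x (fps_var v) e.
  apply: (xgetPex 0 (P := [set c | exists K, forall k, (K <= k)%N -> s k e = c])).
  by exists (s (e v).+1 e), (e v).+1.
by exists K.
Qed.

End FormalPowerSeries.

(* The variables are a_i, indexed by Some i, and q, indexed by None. *)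
Definition var_a (n : nat) (i : 'I_n) : fps (option 'I_n) := fps_var (Some i).
Definition var_q (n : nat) : fps (option 'I_n) := fps_var None.

(* The sum over m and u of F(a^u, m) a^u q^m. *)
Definition gen_series (n : nat) (F : {ffun 'I_n -> nat} -> nat -> nat) :
    fps (option 'I_n) :=
  fun e => (F [ffun i => e (Some i)] (e None))%:Z.

Arguments var_q n : clear implicits.

(* Main.v *)
(** Let [unwind] send a sequence [nu] of E to a sequence of primary parts,
    working from the right: primary parts are kept, and a secondary part
    [s] moves to the right through the already unwound tail, the passage of
    a primary part [x] turning [s, x] into [x + 1, s - 1], until its lower half
    is [succ] to the next part; there it splits into its two halves.
    Conversely, in a sequence of O the leftmost pair of neighbours that are
    not [gg] are the two halves of a secondary part; fusing them and moving
    the result to the left as long as it violates [gg] gives the first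
    secondary part of [nu].  The two processes are inverse to each other
    exactly on those [nu] in which every secondary part is [gg] to the head
    of its unwound tail.  That head is the term [nu_Br + (Br - i) / 2 - 1]
    whenever it passes the secondary part at [i], and [Br i = i] otherwise;
    and a violation always propagates to the left along a run of consecutive
    secondary parts that are not [triangle], so testing the first element of
    each run, as E_1 does, is enough.

    The product formula is the expansion of a finite product of factors
    [1 + a_i q^k] over the sets of pairs [(i, k)]. *)

Require Import Defs.
From mathcomp Require Import all_boot all_order all_algebra finmap.
From mathcomp Require Import boolp classical_sets functions cardinality zify.

Set Implicit Arguments.
Unset Strict Implicit.
Unset Printing Implicit Defensive.

Import Order.TTheory GRing.Theory Num.Theory.
Local Open Scope ring_scope.

(** * Comparisons of parts and halves *)

Section Comparisons.
Variable n : nat.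
Implicit Types (i j : 'I_n) (q : secondary n) (x y z : part n) (k l : int).

Lemma succE x y :
  succ x y = (y.1 < x.1) || (y.1 == x.1) && ~~ color_le x.2 y.2.
Proof. by rewrite /succ; case: (color_le _ _) => /=; lia. Qed.

Lemma succeq_pp k l i j : succeq (k, inl i : color n) (l, inl j) =
  (l < k) || (l == k) && (j <= i)%N.
Proof.
rewrite /succeq succE /color_le /= !xpair_eqE.
have -> : (inl i == inl j :> color n) = (i == j :> nat) by [].
have := ltn_ord i; have := ltn_ord j; lia.
Qed.

Lemma gg_pp k l i j : gg (k, inl i : color n) (l, inl j) =
  succeq (k, inl i : color n) (l + 1, inl j).
Proof. by []. Qed.

Lemma gg_sp k q x : is_primary x.2 ->
  gg (k, inr q) x = succ (k, inr q) (shift x 1).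
Proof. by case: x => l [i|//] _;
  rewrite /gg /= /succeq xpair_eqE andbF orbF. Qed.

Lemma gg_ps k q x : is_primary x.2 -> gg x (k, inr q) = succ x (k + 1, inr q).
Proof. by case: x => l [i|//] _;
  rewrite /gg /= /succeq xpair_eqE andbF orbF. Qed.

Let sec i j (ij : (i < j)%N) : color n := inr (exist _ (i, j) ij).

Lemma succ_pp k l i j :
  succ (k, inl i : color n) (l, inl j) = (l < k) || (l == k) && (j < i)%N.
Proof.
rewrite succE /color_le /=; have := ltn_ord i; have := ltn_ord j; lia.
Qed.

Lemma succ_ps k l i (i' j' : 'I_n) (ij' : (i' < j')%N) :
  succ (k, inl i) (l, sec ij') = (l < k) || (l == k) && (i' <= i)%N.
Proof.
rewrite succE /color_le /=; have := ltn_ord j'; lia.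
Qed.

Lemma succ_sp k l i (i' j' : 'I_n) (ij' : (i' < j')%N) :
  succ (k, sec ij') (l, inl i) = (l < k) || (l == k) && (i < i')%N.
Proof.
rewrite succE /color_le /=; have := ltn_ord j'; lia.
Qed.

Lemma succ_ss k l (i j i' j' : 'I_n) (ij : (i < j)%N) (ij' : (i' < j')%N) :
  succ (k, sec ij) (l, sec ij') =
  (l < k) || (l == k) && ((i' < i)%N || (i' == i :> nat) && (j' < j)%N).
Proof. by rewrite succE /color_le /=; lia. Qed.

(** The two cases of [gg] merge into one disjunction because being [succ] to the raised part implies
    being [succ] to the part itself, so the first disjunct adds nothing for special pairs. *)
Lemma gg_ss k l (i j i' j' : 'I_n) (ij : (i < j)%N) (ij' : (i' < j')%N) :
  gg (k, sec ij) (l, sec ij') =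
  succ (k, sec ij) (l + 1, sec ij') ||
  ([&& i' < j', j' < i & i < j]%N || [&& i < i', i' < j' & j' < j]%N) &&
  succ (k, sec ij) (l, sec ij').
Proof.
rewrite /gg /=; case: ifP => [_ | _] /=; last by rewrite orbF.
by rewrite !succ_ss; lia.
Qed.

(** Replaces division by two with [h + h] or [h + h + 1], a form that linear arithmetic can
    handle. *)
Lemma halves_parity k q : exists h : int,
  (k = h + h /\ upper_half k q = (h, inl (val q).2) /\
                lower_half k q = (h, inl (val q).1)) \/
  (k = h + h + 1 /\ upper_half k q = (h + 1, inl (val q).1) /\
                lower_half k q = (h, inl (val q).2)).
Proof.
exists (k %/ 2)%Z; rewrite /upper_half /lower_half.
by case: eqP => ?; [left | right]; do ![split] => //; lia.
Qed.

End Comparisons.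


Ltac name_halves k q :=
  have := halves_parity k q;
  let u := fresh in let l := fresh in
  case=> ? [] [? [u l]]; rewrite ?u ?l /shift /=; clear u l.

(** Once primary parts, secondary colors and ordinals are broken into numbers, every comparison is
    linear arithmetic on sizes and color indices. *)
Ltac color_lia :=
  repeat match goal with
  | H : is_true (is_primary (snd ?x)) |- _ => is_var x;
    case: x H => ? [?|//] /= ?
  | q : secondary _ |- _ => case: q => -[? ?] /= ?
  end;
  rewrite /triangle /shift /= ?gg_ss ?gg_sp ?gg_ps ?gg_pp // /shift
    ?succeq_pp ?succ_pp ?succ_ps ?succ_sp ?succ_ss;
  repeat match goal with i : 'I_ _ |- _ => revert dependent i; case=> ? ? /=;
    intros end;
  lia.

Section Inequalities.
Variable n : nat.
Implicit Types (i j : 'I_n) (q : secondary n) (x y z : part n) (k l : int).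

Lemma shiftA x (a b : int) : shift (shift x a) b = shift x (a + b).
Proof. by rewrite /shift addrA. Qed.

Lemma shift0 x : shift x 0 = x.
Proof. by case: x => k p; rewrite /shift addr0. Qed.

Lemma succ_shift x y (a : int) : succ (shift x a) (shift y a) = succ x y.
Proof. by rewrite !succE /=; lia. Qed.

Lemma succeq_shift x y (a : int) : succeq (shift x a) (shift y a) = succeq x y.
Proof.
rewrite /succeq succ_shift; case: x y => [k p] [l r].
by rewrite /shift !xpair_eqE (inj_eq (addIr a)).
Qed.

Lemma gg_shift x y (a : int) : gg (shift x a) (shift y a) = gg x y.
Proof.
have shiftC (u : part n) : shift (shift u a) 1 = shift (shift u 1) a.
  by rewrite !shiftA addrC.
by rewrite /gg shiftC succeq_shift !succ_shift.
Qed.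

Lemma succ_trans : transitive (@succ n).
Proof. by move=> [? p] [? r] [? t]; rewrite !succE /color_le /=;
  case: (color_key p) (color_key r) (color_key t) => ? ? [? ?] [? ?]; lia. Qed.

Lemma succ_succeq_trans x y z : succ x y -> succeq y z -> succ x z.
Proof. by move=> xy /orP[|/eqP<- //]; apply: succ_trans xy. Qed.

Lemma succ_irr : irreflexive (@succ n).
Proof. by move=> [? p]; rewrite !succE /color_le /=;
  case: (color_key p) => ? ?; lia. Qed.

Lemma succ_asym x y : succ x y -> ~~ succ y x.
Proof. by move=> xy; apply/negP => /(succ_trans xy); rewrite succ_irr. Qed.

Lemma upper_primary k q : is_primary (upper_half k q).2.
Proof. by name_halves k q. Qed.

Lemma lower_primary k q : is_primary (lower_half k q).2.
Proof. by name_halves k q. Qed.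

(** Raising the size by one makes the halves exchange roles: the old upper half becomes the lower
    one, and the old lower half, raised by one, the upper one. *)
Lemma upper_halfS k q : upper_half (k + 1) q = shift (lower_half k q) 1.
Proof. by name_halves k q; name_halves (k + 1) q; try lia; congr pair; lia. Qed.

Lemma lower_halfS k q : lower_half (k + 1) q = upper_half k q.
Proof. by name_halves k q; name_halves (k + 1) q; try lia; congr pair; lia. Qed.

Lemma halves_weight k q : (upper_half k q).1 + (lower_half k q).1 = k.
Proof. by name_halves k q; lia. Qed.

Lemma halves_monomial k q : color_monomial (upper_half k q).2 +
  color_monomial (lower_half k q).2 = color_monomial (inr q).
Proof. by name_halves k q; apply/ffunP=> i; rewrite !ffunE //= addrC. Qed.

Lemma halves_inj k q k' q' : upper_half k q = upper_half k' q' ->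
  lower_half k q = lower_half k' q' -> (k, q) = (k', q').
Proof.
move=> eq_up eq_lo; have := halves_weight k q.
rewrite eq_up eq_lo halves_weight => eq_k; subst k'; congr pair; apply: val_inj.
by move: eq_up eq_lo; name_halves k q; name_halves k q'; try lia;
  move=> [_ e1] [_ e2]; rewrite [val q]surjective_pairing
    [RHS]surjective_pairing e1 e2.
Qed.

Lemma succ_halves k q : succ (upper_half k q) (lower_half k q).
Proof. by name_halves k q; color_lia. Qed.

Lemma gg_halves k q : ~~ gg (upper_half k q) (lower_half k q).
Proof. by name_halves k q; color_lia. Qed.

(** From [x] to [y] the sizes drop by one if the colors increase and agree if the colors decrease:
    these are the odd and the even shape of the halves of a secondary part. With [gg_halves] this
    identifies close pairs with pairs of halves. *)
Lemma close_halves x y : is_primary x.2 -> is_primary y.2 -> succ x y ->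
  ~~ gg x y -> exists k q, x = upper_half k q /\ y = lower_half k q.
Proof.
case: x y => [k [i|//]] [l [j|//]] _ _.
rewrite gg_pp succeq_pp succE /color_le /= => xy nxy.
have := ltn_ord i; have := ltn_ord j => lt_i lt_j.
case: (ltngtP i j) => ij; last by lia.
- pose q : secondary n := exist _ (i, j) ij.
  exists (k + l), q; have -> : k = l + 1 by lia.
  by name_halves (l + 1 + l) q; try lia; split; congr pair; lia.
- pose q : secondary n := exist _ (j, i) ij.
  exists (k + l), q; have -> : k = l by lia.
  by name_halves (l + l) q; try lia; split; congr pair; lia.
Qed.

Lemma lower_lt_sec k q y : is_primary y.2 -> 2 <= k ->
  succ (lower_half k q) y -> gg (k, inr q) y.
Proof. by move=> y_pr ?; name_halves k q; color_lia. Qed.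

Lemma gg_upper k q x : is_primary x.2 -> 2 <= k -> gg x (k, inr q) ->
  gg x (upper_half k q).
Proof. by move=> x_pr ?; name_halves k q; color_lia. Qed.

Lemma gg_sec_crossed k q x y : is_primary x.2 -> is_primary y.2 ->
  gg x (k, inr q) -> gg (k, inr q) y -> gg x (shift y 1).
Proof. by move=> x_pr y_pr; color_lia. Qed.

Lemma gg_pred k q x y : is_primary x.2 -> gg (k, inr q) x -> gg x y ->
  gg (k - 1, inr q) y.
Proof.
move=> x_pr; case: y => [l [i|q']] /=; last by color_lia.
by rewrite [gg (k, _) _]gg_sp // [gg (k - 1, _) _]gg_sp //; color_lia.
Qed.

Lemma gg_crossed_upper k q x : is_primary x.2 -> ~~ succ (lower_half k q) x ->
  gg (shift x 1) (upper_half (k - 1) q).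
Proof.
move=> x_pr; rewrite -{1}(subrK 1 k) lower_halfS.
by name_halves (k - 1) q; color_lia.
Qed.

(** After a passage to the left the two parts are [gg] exactly when they were not before, so each
    step repairs a violation and can be undone. *)
Lemma gg_crossed k q x : is_primary x.2 ->
  gg (k + 1, inr q) (shift x (-1)) = ~~ gg x (k, inr q).
Proof. by move=> x_pr; color_lia. Qed.

(* A secondary part that passes the upper half of a smaller secondary part is
   stopped by its lower half.  This is the point of the special pairs. *)
Lemma lower_stop k q k2 q2 : gg (k, inr q) (k2, inr q2) ->
  ~~ succ (lower_half k q) (upper_half k2 q2) ->
  succ (lower_half (k - 1) q) (lower_half k2 q2).
Proof.
by name_halves k q; name_halves (k - 1) q; name_halves k2 q2; try lia;
  color_lia.
Qed.

Lemma pull_crossed_size k q x y : is_primary x.2 -> 1 < x.1 -> is_primary y.2 ->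
  2 <= k + 1 -> gg x y -> succeq y (upper_half k q) -> ~~ gg x (k, inr q) ->
    2 <= k.
Proof.
move=> x_pr x_gt1 y_pr ?; name_halves k q; move: x_gt1; color_lia.
Qed.

Lemma gg_succ_trans x y z : is_primary x.2 -> is_primary y.2 ->
  is_primary z.2 ->
  gg x y -> succ y z -> succ (shift x (-1)) z.
Proof. by move=> x_pr y_pr z_pr; color_lia. Qed.

Lemma uncross_upper k q x y : is_primary x.2 -> is_primary y.2 -> gg x y ->
  succeq y (upper_half k q) -> ~~ succ (upper_half k q) (shift x (-1)).
Proof. by move=> x_pr y_pr; name_halves k q; color_lia. Qed.

Lemma uncross_gt0 x y : is_primary x.2 -> is_primary y.2 -> 0 < y.1 -> gg x y ->
  1 < x.1.
Proof. by move=> x_pr y_pr; color_lia. Qed.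

Lemma crossed_upper k q y : is_primary y.2 -> ~~ succ (lower_half k q) y ->
  succeq (shift y 1) (upper_half k q).
Proof. by move=> y_pr; name_halves k q; color_lia. Qed.

Lemma triangle_crossed k q k2 q2 y : is_primary y.2 ->
  triangle (k, inr q) (k2, inr q2) -> gg (k2, inr q2) y ->
    gg (k, inr q) (shift y 1).
Proof. by move=> y_pr; color_lia. Qed.

Lemma not_triangle_crossed k q k2 q2 y : is_primary y.2 ->
  ~~ triangle (k, inr q) (k2, inr q2) -> ~~ gg (k2, inr q2) y ->
  ~~ gg (k, inr q) (shift y 1).
Proof. by move=> y_pr; color_lia. Qed.

Lemma gg_sec_upper k q k2 q2 : 2 <= k2 -> gg (k, inr q) (k2, inr q2) ->
  gg (k, inr q) (upper_half k2 q2).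
Proof. by move=> ?; name_halves k2 q2; color_lia. Qed.

Lemma gg_two_secs k q k2 q2 : succ (lower_half k q) (upper_half k2 q2) ->
  gg (k, inr q) (k2, inr q2).
Proof. by name_halves k q; name_halves k2 q2; color_lia. Qed.

Lemma gg_two_secs_crossed k q k2 q2 : succ (lower_half k q) (lower_half k2 q2)
  ->
  succeq (upper_half k2 q2) (upper_half k q) ->
  ~~ gg (shift (upper_half k2 q2) 1) (k, inr q) ->
    gg (k + 1, inr q) (k2, inr q2).
Proof. by name_halves k q; name_halves k2 q2; color_lia. Qed.

End Inequalities.

(** * Unwinding secondary parts *)

Section Unwinding.
Variable n : nat.
Implicit Types (q : secondary n) (x y z : part n) (k : int).
Implicit Types l r nu : seq (part n).

Definition lead x l : bool := if l is y :: _ then gg x y else true.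

Fixpoint push k q l : seq (part n) :=
  if l is x :: l' then
    if succ (lower_half k q) x then [:: upper_half k q, lower_half k q & l]
    else shift x 1 :: push (k - 1) q l'
  else [:: upper_half k q; lower_half k q].

Fixpoint unwind nu : seq (part n) :=
  if nu is (k, p) :: nu' then
    match p with
    | inl _ => (k, p) :: unwind nu'
    | inr q => push k q (unwind nu')
    end
  else [::].

Lemma push_primary k q l : all (fun x => is_primary x.2) l ->
  all (fun x => is_primary x.2) (push k q l).
Proof.
elim: l k => [|x l IHl] k /=; first by rewrite upper_primary lower_primary.
case/andP=> x_pr l_pr; case: ifP => _ /=; last by rewrite x_pr IHl.
by rewrite upper_primary lower_primary x_pr.
Qed.

Lemma unwind_primary nu : all (fun x => is_primary x.2) (unwind nu).
Proof. by elim: nu => //= -[k [i|q]] nu IHnu //=; apply: push_primary. Qed.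

(* The condition of E_1 on secondary parts,
  in a form that passes to suffixes. *)
Fixpoint clear nu : bool :=
  if nu is x :: nu' then
    (is_primary x.2 || lead x (unwind nu')) && clear nu'
  else true.

Lemma clearP x0 nu : reflect
  (forall a, (a < size nu)%N -> is_primary (nth x0 nu a).2 \/
     lead (nth x0 nu a) (unwind (drop a.+1 nu)))
  (clear nu).
Proof.
elim: nu => [|x nu IHnu] /=; first by left.
apply: (iffP andP) => [[/orP x_ok /IHnu nu_cl] [|a] //= lt_a|cl];
  first by rewrite drop0.
  exact: nu_cl.
split; first by have /orP := cl 0%N isT; rewrite /= drop0.
by apply/IHnu => a lt_a; apply: (cl a.+1).
Qed.

(* [pull l k q r]: the leftmost close pair of [l] is fused and can be moved to
   the front of [l], where it becomes the secondary part [(k, inr q)], leaving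
   [r] behind. *)
Inductive pull : seq (part n) -> int -> secondary n -> seq (part n) -> Prop :=
| PullHere k q l : pull [:: upper_half k q, lower_half k q & l] k q l
| PullThere k q x l r of pull l k q r & is_primary x.2 & lead x l
    & ~~ gg x (k, inr q) : pull (x :: l) (k + 1) q (shift x (-1) :: r).

Lemma pull_inv l k q r : pull l k q r ->
  l = [:: upper_half k q, lower_half k q & r] \/
  exists k' x l' r', [/\ l = x :: l', k = k' + 1 & r = shift x (-1) :: r'] /\
    [/\ pull l' k' q r', is_primary x.2, lead x l' & ~~ gg x (k', inr q)].
Proof.
case=> [*|k' q' x l' r' *]; first by left.
by right; exists k', x, l', r'.
Qed.

Lemma size_pull l k q r : pull l k q r -> size l = (size r).+2.
Proof. by elim=> //= ? ? ? ? ? _ ->. Qed.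

(** At most one constructor applies: two halves are never [gg], against the [lead] condition of
    [PullThere]. *)
Lemma pull_det l k q r k' q' r' :
  pull l k q r -> pull l k' q' r' -> [/\ k = k', q = q' & r = r'].
Proof.
move=> lr; elim: lr k' q' r' => {l k q r} [k q l|k q x l r _ IHl _ xl _] k' q'
  r'.
  case/pull_inv=> [[eq_u eq_l ->] | [? [? [? [? [[[<- <-] _ _] [_ _]]]]]]].
    by have [-> ->] := halves_inj eq_u eq_l.
  by rewrite /= (negPf (gg_halves _ _)).
case/pull_inv=> [[eq_x eq_l] | [? [? [? [? [[[<- <-] -> ->] [lr' _ _ _]]]]]]].
  by move: xl; rewrite eq_x eq_l /= (negPf (gg_halves _ _)).
by have [-> -> ->] := IHl _ _ _ lr'.
Qed.

Lemma gg_succ x y : is_primary x.2 -> is_primary y.2 -> gg x y -> succ x y.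
Proof. by move=> x_pr y_pr; color_lia. Qed.

(** The bound on the upper half is what later forces [push] to cross again each part that [pull] has
    crossed. *)
Lemma pull_head y l k q r : pull (y :: l) k q r ->
  is_primary y.2 /\ succeq y (upper_half k q).
Proof.
move E: (y :: l) => l' lr; elim: lr y l E => {l' k q r}
  [k q l|k q x l r lr IHl x_pr xl _] y l' [-> _].
  by rewrite upper_primary /succeq eqxx orbT.
split=> //; case: l lr xl IHl => [/size_pull //|z l _ /= xz IHl].
have [z_pr zu] := IHl _ _ erefl; rewrite upper_halfS.
move: x_pr z_pr xz zu; clear.
case: x z => kx [i|//] [kz [j|//]] _ _; name_halves k q; color_lia.
Qed.

(** Followed from left to right, the secondary part loses one at each passage, but
    [pull_crossed_size] keeps its size at least two, so both halves are positive when it splits. *)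
Lemma pull_in_P l k q r : pull l k q r -> 2 <= k -> all (@in_P n) r ->
  all (@in_P n) l.
Proof.
elim=> {l k q r} [k q l k_ge2 /= ->|k q x l r lr IHl x_pr xl xs k_ge2
  /andP[x_gt1 r_P]].
  by rewrite /in_P upper_primary lower_primary; name_halves k q => /=; lia.
have {}x_gt1 : 1 < x.1 by move: x_gt1 => /andP[_] /=; lia.
rewrite /= {1}/in_P x_pr (_ : 0 < x.1 = true) /=; last by lia.
apply: IHl => //; case: l xl lr => [_ /size_pull //|y l /= xy lr].
have [y_pr yu] := pull_head lr.
exact: pull_crossed_size x_pr x_gt1 y_pr k_ge2 xy yu xs.
Qed.

Lemma pull_cross k q x l r : pull l (k - 1) q r -> is_primary x.2 ->
  lead (shift x 1) l -> gg (k, inr q) x -> pull (shift x 1 :: l) k q (x :: r).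
Proof.
move=> lr x_pr xl sx; have := PullThere lr (x := shift x 1) x_pr xl.
rewrite subrK shiftA subrr shift0; apply.
by rewrite -gg_crossed // subrK shiftA subrr shift0.
Qed.

(** The first secondary part follows the path of the second: both lose one at each common passage
    and stay [gg]. If the first gets as far as the halves of the second, it passes at most the upper
    one, by [lower_stop]. *)
Lemma pull_push k q l k2 q2 r : pull l k2 q2 r -> gg (k, inr q) (k2, inr q2) ->
  lead (k, inr q) l -> pull (push k q l) k q l.
Proof.
move=> lr; elim: lr k => {l k2 q2 r} [k2 q2 l|k2 q2 x l r lr IHl x_pr xl xs2] k
  ss2 sl /=.
  case: ifPn => [_|cross]; first exact: PullHere.
  rewrite (lower_stop ss2 cross).
  apply: pull_cross sl; rewrite ?upper_primary //=; first exact: PullHere.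
  exact: gg_crossed_upper (upper_primary _ _) cross.
case: ifPn => [_|cross]; first exact: PullHere.
apply: pull_cross => //.
- apply: IHl; first by rewrite -(gg_shift _ _ 1) /shift /= subrK.
  by case: (l) xl => //= y l' xy; apply: gg_pred x_pr sl xy.
- case: (l) xl => [_|y l' /= xy] /=; first exact: gg_crossed_upper.
  by case: ifP => _ /=; [exact: gg_crossed_upper | rewrite gg_shift].
Qed.

Lemma in_O_cons x l : in_O (x :: l) =
  [&& in_P x, (if l is y :: _ then succ x y else true) & in_O l].
Proof.
rewrite /in_O /= -andbA; congr andb.
by case: l => [|y l] //=; rewrite andbCA.
Qed.

Lemma in_E_cons x l : in_E (x :: l) = [&& in_P x || in_S x, lead x l & in_E l].
Proof.
rewrite /in_E /= -andbA; congr andb.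
by case: l => [|y l] //=; rewrite andbCA.
Qed.

Lemma push_sorted k q l : sorted (@succ n) l -> all (@in_P n) l ->
  sorted (@succ n) (push k q l).
Proof.
elim: l k => [k _ _|x l IHl k xl /andP[/andP[x_pr _] l_P]] /=.
  by rewrite succ_halves.
case: ifPn => [lo_x|cross] /=; first by rewrite succ_halves lo_x.
have /= := IHl (k - 1) (path_sorted xl) l_P.
have x_up : succ (shift x 1) (upper_half (k - 1) q).
  by move: cross x_pr; rewrite -{1}(subrK 1 k) lower_halfS;
    case: x {xl} => ? [i|//];
     name_halves (k - 1) q; move=> cross _; move: cross; color_lia.
case: l xl {IHl l_P} => [|y l] /=; first by rewrite x_up.
by case: ifP => _ /= /andP[xy _]; rewrite ?x_up // succ_shift xy.
Qed.

(** The three claims support each other in the induction: the second places a primary part in front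
    of the tail, and the third, that a pushed secondary part can be pulled out again, yields the
    positivity needed for the first. *)
Lemma unwindP nu : in_E nu -> clear nu ->
  [/\ in_O (unwind nu),
      forall x, is_primary x.2 -> lead x nu -> lead x (unwind nu)
    & forall k q, lead (k, inr q) nu -> lead (k, inr q) (unwind nu) ->
      pull (push k q (unwind nu)) k q (unwind nu)].
Proof.
elim: nu => [_ _|[k [i|q]] nu IHnu]; first by split=> // k q _ _;
  apply: PullHere.
all: rewrite in_E_cons => /and3P[x_ok x_nu nuE] /=.
  have x_P : in_P (k, inl i) by case/orP: x_ok => // /andP[].
  move=> nu_cl; have [nuO lead_nu pull_nu] := IHnu nuE nu_cl.
  have xl := lead_nu (k, inl i) isT x_nu.
  have nu_P y l : unwind nu = y :: l -> is_primary y.2.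
    by move=> E; move: nuO; rewrite E in_O_cons => /andP[/andP[]].
  split=> //.
    rewrite in_O_cons x_P nuO andbT /=.
    case E: (unwind nu) xl => [|y l] //= xy.
    by apply: gg_succ xy; rewrite ?(nu_P _ _ E).
  move=> k2 q2 sx _ /=; case: ifPn => [_|cross]; first exact: PullHere.
  have lead_pred l : lead (k, inl i) l -> lead (k2 - 1, inr q2) l.
    by case: l => //= y l xy; apply: (gg_pred (x := (k, inl i))).
  apply: pull_cross => //; first by apply: pull_nu; exact: lead_pred.
  case: (unwind nu) xl => [_|y l /= xy] /=; first exact: gg_crossed_upper.
  by case: ifP => _ /=; [exact: gg_crossed_upper | rewrite gg_shift].
have k_ge2 : 2 <= k by case/orP: x_ok => /andP[].
move=> /andP[sl nu_cl]; have [nuO _ pull_nu] := IHnu nuE nu_cl.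
have /andP[nu_P nu_sorted] := nuO.
have lr := pull_nu k q x_nu sl.
split; first by rewrite /in_O (pull_in_P lr) ?push_sorted.
  move=> x x_pr xs; case E: (unwind nu) sl => [|y l] /= sl;
    first exact: gg_upper.
  have /andP[y_pr _] : in_P y by move: nu_P; rewrite E => /andP[].
  case: ifP => _ /=; first exact: gg_upper x_pr k_ge2 xs.
  exact: gg_sec_crossed x_pr y_pr xs sl.
by move=> k2 q2 ss2 sl2; apply: pull_push lr ss2 sl2.
Qed.

(** By [pull_det], only the first secondary part of a sequence that starts with it can be pulled to
    the front; the primary part before it is [gg] to it, which forbids the last passage. *)
Lemma unwind_no_pull x nu k q r : in_E (x :: nu) -> clear (x :: nu) ->
  is_primary x.2 -> ~ pull (unwind (x :: nu)) k q r.
Proof.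
elim: nu x k q r => [|y nu IHnu] [kx [i|//]] k q r xE x_cl _;
  first by move/size_pull.
move: (xE) (x_cl); rewrite in_E_cons [clear _]/= => /and3P[_ x_nu nuE] nu_cl.
have [nuO lead_nu _] := unwindP nuE nu_cl.
have xl := lead_nu (kx, inl i) isT x_nu.
have -> : unwind [:: (kx, inl i), y & nu] = (kx,
  inl i) :: unwind (y :: nu) by [].
set u := unwind (y :: nu) in xl *.
case/pull_inv=> [[eq_x eq_l] | [k' [z [l' [r' [[[<- <-] _ _] [lr _ _ xs]]]]]]].
  by move: xl; rewrite eq_x eq_l /= (negPf (gg_halves _ _)).
move: nuE nu_cl lr x_nu; rewrite {xl}/u;
  case: y {xE x_cl nuO lead_nu} => [ky [j|q2]] nuE nu_cl lr x_nu.
  exact: IHnu nuE nu_cl isT lr.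
move: nuE nu_cl; rewrite in_E_cons [clear _]/= =>
  /and3P[_ s_nu nuE] /andP[sl nu_cl].
have [_ _ pull_nu] := unwindP nuE nu_cl.
have [ek eq _] := pull_det lr (pull_nu _ _ s_nu sl).
by case/negP: xs; rewrite ek eq.
Qed.

(** Whether something can be pulled to the front tells if the first part is secondary, and
    [pull_det] then recovers that part and the unwound tail. *)
Lemma unwind_inj nu nu' : in_E nu -> clear nu -> in_E nu' -> clear nu' ->
  unwind nu = unwind nu' -> nu = nu'.
Proof.
have pull_sec k q t : in_E ((k, inr q) :: t) -> clear ((k, inr q) :: t) ->
    [/\ in_E t, clear t & pull (unwind ((k, inr q) :: t)) k q (unwind t)].
  rewrite in_E_cons [clear _]/= => /and3P[_ s_t tE] /andP[sl t_cl]; split=> //.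
  by have [_ _] := unwindP tE t_cl; apply.
elim: nu nu' => [|[k [i|q]] t IHt] [|[k' [i'|q']] t'] // E cl E' cl' eq_u.
- by have [_ _ /size_pull] := pull_sec _ _ _ E' cl'; rewrite -eq_u.
- move: eq_u E cl E' cl'; rewrite ![unwind _]/= => -[-> -> eq_u].
  rewrite !in_E_cons ![clear _]/= => /and3P[_ _ E] cl /and3P[_ _ E'] cl'.
  by rewrite (IHt t').
- have [_ _ lr] := pull_sec _ _ _ E' cl'; rewrite -eq_u in lr.
  by case: (unwind_no_pull E cl isT lr).
- by have [_ _ /size_pull] := pull_sec _ _ _ E cl; rewrite eq_u.
- have [_ _ lr] := pull_sec _ _ _ E cl; rewrite eq_u in lr.
  by case: (unwind_no_pull E' cl' isT lr).
- have [tE t_cl lr] := pull_sec _ _ _ E cl.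
  have [tE' t_cl' lr'] := pull_sec _ _ _ E' cl'; rewrite -eq_u in lr'.
  have [-> -> eq_t] := pull_det lr lr'.
  by rewrite (IHt t').
Qed.

End Unwinding.

(** * Winding, the inverse of unwinding *)

Section Winding.
Variable n : nat.
Implicit Types (q : secondary n) (x y z : part n) (k : int).
Implicit Types l r nu : seq (part n).

Lemma in_O_lead x l : in_O (x :: l) ->
  [/\ in_P x, forall y l', l = y :: l' -> succ x y & in_O l].
Proof.
rewrite in_O_cons => /and3P[xP xl lO]; split=> // y l' eq_l.
by rewrite eq_l in xl.
Qed.

(** The last conjunct, comparing the heads of [l] and [r], serves the induction: with [lead x l] it
    places [x - 1] above the head of [r]. *)
Lemma pullP l k q r : pull l k q r -> in_O l ->
  [/\ 2 <= k, in_O r, lead (k, inr q) r, push k q r = l &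
      forall y z l' r', l = y :: l' -> r = z :: r' -> succ y z].
Proof.
elim=> {l k q r} [k q l|k q x l r lr IHl x_pr xl xs].
  case/in_O_lead=> u_P _ /in_O_lead[l_P lo_l lO].
  have k_ge2 : 2 <= k.
    by case/andP: l_P => _; case/andP: u_P => _; name_halves k q => /=; lia.
  split=> //.
  - case: l lO lo_l => //= y l /in_O_lead[/andP[y_pr _] _ _] lo_l.
    exact: lower_lt_sec y_pr k_ge2 (lo_l _ _ erefl).
  - by case: l lo_l {lO} => //= y l /(_ _ _ erefl) ->.
  - move=> y z l' r' [<- _] eq_l; apply: succ_trans (succ_halves k q) _.
    exact: lo_l eq_l.
case/in_O_lead=> x_P _ lO; have [k_ge2 rO sr eq_l lr_gt] := IHl lO.
case: l lr xl IHl lO eq_l lr_gt => [/size_pull //|y l lr /= xy _ lO eq_l lr_gt].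
have [y_pr y_up] := pull_head lr.
have [/andP[_ y_gt0] _ _] := in_O_lead lO.
split=> //.
- by rewrite (le_trans k_ge2) // lerDl.
- rewrite in_O_cons rO andbT; apply/andP; split.
    by have := uncross_gt0 x_pr y_pr y_gt0 xy; rewrite /in_P x_pr /= subr_gt0.
  case: r rO lr_gt {lr sr eq_l} => // z r /in_O_lead[/andP[z_pr _] _ _] /(_ _ _
    _ _ erefl erefl) yz.
  exact: gg_succ_trans xy yz.
- by rewrite /= gg_crossed.
- rewrite -eq_l /= lower_halfS.
  by rewrite (negPf (uncross_upper x_pr y_pr xy y_up)) addrK shiftA addNr
    shift0.
- move=> ? ? ? ? [<- _] [<- _]; case: (x) => ? ?.
  by rewrite succE /= gtrDl.
Qed.

(** Converse of [pull_push]: secondary parts extracted one after the other are [gg]. *)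
Lemma pull_twice l k q r k2 q2 r2 : pull l k q r -> in_O l ->
  pull r k2 q2 r2 -> gg (k, inr q) (k2, inr q2).
Proof.
move=> lr; elim: lr k2 q2 r2 => {l k q r} [k q l|k q x l r lr IHl x_pr xl xs]
  k2 q2 r2.
  case/in_O_lead=> _ _ /in_O_lead[_ lo_l lO].
  case: l lo_l lO => [_ _ /size_pull //|y l lo_y yO /pull_head[y_pr y_up]].
  apply: gg_two_secs; have := lo_y _ _ erefl.
  by case/orP: y_up => [/[swap]/succ_trans|/eqP<- //]; apply.
case/in_O_lead=> x_P _ lO.
case/pull_inv=> [[eq_x eq_r] | [k2' [z [l' [r' [[[_ <-] -> _] [rr2 _ _ _]]]]]]].
  (* The second close pair starts with [x - 1]. Either the first pair lies between its two members,
     which is the case of [gg_two_secs_crossed], or its other member is also a term lowered by one,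
     and [lead x l] excludes closeness. *)
  case/pull_inv: (lr) => [eq_l | [k' [y [l' [r' [[eq_l _ eq_r2] _]]]]]].
    rewrite eq_l eq_r in lO xl.
    have {}eq_x : x = shift (upper_half k2 q2) 1 by rewrite -eq_x shiftA addNr
      shift0.
    apply: gg_two_secs_crossed.
    - have [_ _ /in_O_lead[_ + _]] := in_O_lead lO.
      exact.
    - rewrite eq_x in xl; move: xl => /=.
      by name_halves k q; name_halves k2 q2; color_lia.
    - by rewrite -eq_x.
  case/negP: (gg_halves k2 q2); rewrite -eq_x.
  move: eq_r2; rewrite eq_r => -[-> _]; rewrite gg_shift.
  by rewrite eq_l in xl.
by rewrite -[gg _ _](gg_shift _ _ (-1)) /shift /= !addrK; apply: IHl rr2.
Qed.

(** Strong induction on the length. If something can be pulled, it becomes the first part and the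
    rest is wound; otherwise the head of [l] is kept as a primary part. *)
Lemma wind l : in_O l -> exists nu, [/\ in_E nu, clear nu & unwind nu = l].
Proof.
have [m le_l] := ubnP (size l); elim: m l le_l => // m IHm l le_l lO.
have [[k [q [r lr]]] | no_pull] := pselect (exists k q r, pull l k q r).
  have [k_ge2 rO sr eq_l _] := pullP lr lO.
  have [|nu [nuE nu_cl eq_r]] := IHm r _ rO.
    by rewrite (size_pull lr) in le_l; rewrite ltnW.
  exists ((k, inr q) :: nu); rewrite in_E_cons /= nuE nu_cl eq_r sr !andbT.
  split=> //; rewrite /in_S /= k_ge2 /=.
  case: nu nuE nu_cl eq_r => // -[kx [i|q2]] nu nuE nu_cl eq_r.
    by rewrite -eq_r in sr.
  move: nuE nu_cl; rewrite in_E_cons => /and3P[_ s_nu nuE] /andP[s_u nu_cl].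
  have [_ _ pull_nu] := unwindP nuE nu_cl.
  by apply: pull_twice lr lO _; rewrite -eq_r; apply: pull_nu.
case: l le_l lO no_pull => [_ _ _|x l le_l /[dup] xlO /in_O_lead[x_P xl lO]
  no_pull].
  by exists [::].
have [nu [nuE nu_cl eq_l]] := IHm l le_l lO.
have /andP[x_pr _] := x_P.
have x_gg : lead x l.
  case: l xl lO {le_l IHm xlO eq_l} no_pull =>
    //= y l xl /in_O_lead[/andP[y_pr _] _ _] no_pull.
  apply: contraT => xy; have [k [q [ex ey]]] := close_halves x_pr y_pr (xl _ _
    erefl) xy.
  by case: no_pull; exists k, q, l; rewrite ex ey; apply: PullHere.
exists (x :: nu); rewrite in_E_cons x_P nuE /= x_pr nu_cl /= andbT; split=> //;
  last first.
  by case: (x) x_pr => kx [i|//] _; rewrite eq_l.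
case: nu nuE nu_cl eq_l => // -[kx [i|q2]] nu nuE nu_cl eq_l.
  by rewrite -eq_l in x_gg.
move: nuE nu_cl; rewrite in_E_cons => /and3P[_ s_nu nuE] /andP[s_u nu_cl].
have [_ _ pull_nu] := unwindP nuE nu_cl.
(* If [x] were not [gg] to the leading secondary part of the wound tail, that part could be pulled
   over [x]. *)
apply: contraT => xs; case: no_pull;
  exists (kx + 1), q2, (shift x (-1) :: unwind nu).
by apply: PullThere => //; rewrite -eq_l; apply: pull_nu.
Qed.

Lemma push_weight k q l : weight (push k q l) = k + weight l.
Proof.
elim: l k => [|x l IHl] k /=; rewrite /weight.
  by rewrite !big_cons big_nil addr0 addr0 halves_weight.
case: ifP => _; rewrite !big_cons; first by rewrite addrA halves_weight.
by rewrite -/(weight _) IHl -/(weight l) /=; lia.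
Qed.

Lemma unwind_weight nu : weight (unwind nu) = weight nu.
Proof.
elim: nu => //= -[k [i|q]] nu IHnu;
  last by rewrite push_weight IHnu /weight big_cons.
by rewrite /weight !big_cons; congr (_ + _).
Qed.

Lemma push_monomial k q l : monomial (push k q l) = color_monomial (inr q) +
  monomial l.
Proof.
elim: l k => [|x l IHl] k /=; rewrite /monomial.
  by rewrite !big_cons big_nil addr0 addr0 halves_monomial.
case: ifP => _; rewrite !big_cons; first by rewrite addrA halves_monomial.
by rewrite -/(monomial _) IHl -/(monomial l) /= addrCA.
Qed.

Lemma unwind_monomial nu : monomial (unwind nu) = monomial nu.
Proof.
elim: nu => //= -[k [i|q]] nu IHnu;
  last by rewrite push_monomial IHnu /monomial big_cons.
by rewrite /monomial !big_cons; congr (_ + _).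
Qed.

End Winding.

(** * Bridges *)

Lemma bigmin_eq (e m : nat) (s : seq nat) (P : pred nat) : m \in s -> P m ->
  (forall u, u \in s -> P u -> (m <= u)%N) -> (m <= e)%N ->
  (\big[minn/e]_(u <- s | P u) u)%N = m.
Proof.
move=> m_s Pm le_m le_e; apply/eqP; rewrite eqn_leq; apply/andP; split.
  elim: s m_s {le_m} => //= v s IHs;
    rewrite inE big_cons => /predU1P[<-|/IHs le_s].
    by rewrite Pm geq_minl.
  by case: (P v) => //; rewrite geq_min le_s orbT.
rewrite big_seq_cond; elim/big_ind: _ => //; first by move=> x y;
  rewrite leq_min => -> ->.
by move=> u /andP[]; apply: le_m.
Qed.

(* Index, in the expanded sequence, of the first term coming from position [a]
   of [nu]. *)
Definition offset (n : nat) (nu : seq (part n.+1)) (a : nat) : nat :=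
  flatten_index (shape (blocks nu)) a 0.

Definition part_at (n : nat) (nu : seq (part n.+1)) (a : nat) : part n.+1 :=
  nth (last_part n) nu a.

Definition sec_at (n : nat) (nu : seq (part n.+1)) (a : nat) : bool :=
  is_secondary (part_at nu a).2.

Definition head_from (n : nat) (nu : seq (part n.+1)) (a : nat) :
  option (part n.+1) := ohead (unwind (drop a nu)).

(* The primary part or upper half at position [a + u] passes the secondary part
   at position [a + t], after having passed those in between. *)
Definition crosses (n : nat) (nu : seq (part n.+1)) (a t u : nat) : bool :=
  ~~ succ (eterm nu (offset nu (a + t)).+1)
     (shift (eterm nu (offset nu (a + u))) ((u - t)%N%:Z - 1)).

Section Bridge.
Variables (n : nat) (nu : seq (part n.+1)).
Hypothesis nuE : in_E nu.
Local Open Scope nat_scope.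

Local Notation sh := (shape (blocks nu)).
Local Notation off := (offset nu).
Local Notation nu_ := (part_at nu).
Local Notation sec := (sec_at nu).
Local Notation h := (head_from nu).

Lemma nth_sh a : a < size nu -> nth 0 sh a = (sec a).+1.
Proof.
move=> lt_a; rewrite nth_shape (nth_map (last_part n)) // -/(nu_ a) /sec_at
  /halves.
by case: (nu_ a) => k [i|q].
Qed.

Lemma size_sh : size sh = size nu. Proof. by rewrite !size_map. Qed.

Lemma offS a : a < size nu -> off a.+1 = off a + (sec a).+1.
Proof.
move=> lt_a; rewrite /offset /flatten_index !addn0 (take_nth 0) ?size_sh //
  sumn_rcons.
by rewrite nth_sh.
Qed.

Lemma origin_off a b : a < size nu -> b <= sec a -> origin nu (off a + b) = a.
Proof.
move=> lt_a le_b; rewrite /origin /offset /flatten_index addn0.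
by apply: flatten_indexKl; rewrite nth_sh.
Qed.

Lemma offset_off a b : a < size nu -> b <= sec a ->
  reshape_offset sh (off a + b) = b.
Proof.
move=> lt_a le_b; rewrite /offset /flatten_index addn0.
by apply: flatten_indexKr; rewrite nth_sh.
Qed.

Lemma opart_off a : a < size nu -> opart nu (off a) = nu_ a.
Proof. by move=> lt_a; rewrite /opart -[off a]addn0 origin_off. Qed.

Lemma off_elen a : a < size nu -> off a < elen nu.
Proof. by move=> lt_a; rewrite /elen size_flatten; apply: flatten_indexP;
  rewrite nth_sh. Qed.

Lemma off_size : off (size nu) = elen nu.
Proof. by rewrite /offset /flatten_index addn0 -size_sh take_size /elen
  size_flatten. Qed.

Lemma off_lt a b : a < b <= size nu -> off a < off b.
Proof.
elim: b => // b IHb /andP[]; rewrite ltnS leq_eqVlt => /predU1P[->|lt_ab] le_b.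
  by rewrite offS // addnS ltnS leq_addr.
by rewrite (leq_trans (IHb _)) ?lt_ab ?(ltnW le_b) // offS // leq_addr.
Qed.

Lemma off_leq a b : a <= size nu -> b <= size nu -> (off a <= off b) = (a <= b).
Proof.
move=> le_a le_b; case: (ltngtP a b) => [lt_ab|lt_ba|->]; last by rewrite leqnn.
  by rewrite ltnW // off_lt // lt_ab.
by apply/negbTE; rewrite -ltnNge off_lt // lt_ba.
Qed.

Lemma off_ltn a b : a <= size nu -> b <= size nu -> (off a < off b) = (a < b).
Proof. by move=> le_a le_b; rewrite ltnNge off_leq // -ltnNge. Qed.

Lemma in_I_off a : a < size nu -> in_I nu (off a) = sec a.
Proof.
move=> lt_a; rewrite /in_I off_elen // opart_off //=.
by rewrite -[X in reshape_offset _ X]addn0 offset_off // andbT.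
Qed.

Lemma in_J_off a : a < size nu -> in_J nu (off a) = ~~ sec a.
Proof. by move=> lt_a; rewrite /in_J off_elen // opart_off //= negbK. Qed.

Lemma off_origin i : i < elen nu -> exists a b,
  [/\ a < size nu, b <= sec a, i = off a + b & reshape_offset sh i = b].
Proof.
rewrite /elen size_flatten => lt_i.
have := reshape_indexP lt_i; have := reshape_offsetP lt_i;
  rewrite size_sh => lt_o lt_a.
rewrite nth_sh // ltnS in lt_o.
exists (reshape_index sh i), (reshape_offset sh i); split=> //.
by rewrite -[LHS](reshape_indexK sh) /offset /flatten_index addn0.
Qed.

Lemma in_IP i : in_I nu i -> exists a, [/\ a < size nu, sec a & i = off a].
Proof.
case/and3P=> /off_origin[a [b [lt_a _ -> eq_b]]] + /eqP; rewrite eq_b => + b0.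
by rewrite b0 addn0 opart_off // => sec_a; exists a.
Qed.

Lemma in_JP i : in_J nu i -> exists a, [/\ a < size nu, ~~ sec a & i = off a].
Proof.
case/andP=> /off_origin[a [b [lt_a le_b -> _]]].
rewrite /opart origin_off // => prim_a.
have sec_a : ~~ sec a by rewrite negbK.
exists a; split=> //; move: le_b; rewrite (negPf sec_a) leqn0 => /eqP->.
exact: addn0.
Qed.

Lemma eterm_off a b : a < size nu -> b <= sec a ->
  eterm nu (off a + b) = nth (last_part n) (halves (nu_ a)) b.
Proof.
move=> lt_a le_b; rewrite /eterm nth_flatten offset_off // -/(origin _ _).
by rewrite origin_off // (nth_map (last_part n)).
Qed.

Lemma eterm_primary a : a < size nu -> ~~ sec a -> eterm nu (off a) = nu_ a.
Proof.
move=> lt_a; rewrite -[off a]addn0 eterm_off // /sec_at /halves.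
by case: (nu_ a) => k [].
Qed.

Lemma eterm_upper a k q : a < size nu -> nu_ a = (k, inr q) ->
  eterm nu (off a) = upper_half k q.
Proof. by move=> lt_a E; rewrite -[off a]addn0 eterm_off // E. Qed.

Lemma eterm_lower a k q : a < size nu -> nu_ a = (k, inr q) ->
  eterm nu (off a).+1 = lower_half k q.
Proof.
by move=> lt_a E; rewrite -[in LHS]addn1 eterm_off // /sec_at E.
Qed.

Lemma h_prim a y : h a = Some y -> is_primary y.2.
Proof.
rewrite /head_from; have := unwind_primary (drop a nu).
by case: (unwind _) => //= z l /andP[z_pr _] [<-].
Qed.

Lemma h_none a : size nu <= a -> h a = None.
Proof. by move=> le_a; rewrite /head_from drop_oversize. Qed.

Lemma h_primary a : a < size nu -> ~~ sec a -> h a = Some (eterm nu (off a)).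
Proof.
move=> lt_a prim_a; rewrite eterm_primary // /head_from (drop_nth (last_part
  n)) //.
by move: prim_a; rewrite /sec_at -/(nu_ a); case: (nu_ a) => k [].
Qed.

Lemma h_sec a : a < size nu -> sec a ->
  h a = Some (if h a.+1 is Some y then
                if succ (eterm nu (off a).+1) y then eterm nu (off a) else
                  shift y 1
              else eterm nu (off a)).
Proof.
move=> lt_a; rewrite /sec_at {1}/head_from (drop_nth (last_part n)) // -/(nu_
  a).
case E: (nu_ a) => [k [//|q]] _ /=.
rewrite (eterm_upper lt_a E) (eterm_lower lt_a E) /head_from.
by case: (unwind _) => //= y l; case: ifP.
Qed.

(** * A run of [r] consecutive secondary parts starting at position [a] and ending before a primary
    part or the end of [nu] *)

Section Run.
Variables a r : nat.
Hypothesis r_gt0 : 0 < r.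
Hypothesis le_r : a + r <= size nu.
Hypothesis run : forall t, t < r -> sec (a + t).
Hypothesis run_end : a + r < size nu -> ~~ sec (a + r).

Lemma off_run t : t <= r -> off (a + t) = off a + t.*2.
Proof.
elim: t => [|t IHt] lt_t; first by rewrite !addn0.
have lt_at : a + t < size nu by move: le_r; lia.
by rewrite addnS offS // run // IHt 1?ltnW // doubleS !addnS addn0.
Qed.

Local Notation crosses := (crosses nu a).

Lemma bridge_condP t u : t <= u -> u <= r ->
  reflect (forall s, t <= s < u -> crosses s u)
          (bridge_cond nu (off (a + t)) (off (a + u))).
Proof.
move=> le_tu le_ur.
have half_run s : s <= u -> (off (a + u) - off (a + s))./2 = u - s.
  move=> le_su; rewrite !off_run ?(leq_trans le_su) // subnDl -doubleB.
  exact: doubleK.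
apply: (iffP allP) => [cond s /andP[le_ts lt_su] | cond i].
  have /cond : off (a + s) \in [seq i <- index_iota (off (a + t)) (off (a + u))
    | in_I nu i].
    rewrite mem_filter in_I_off ?run ?(leq_trans lt_su) //=; last by lia.
    rewrite mem_index_iota off_leq ?off_ltn; lia.
  by rewrite half_run // ltnW.
rewrite mem_filter mem_index_iota => /andP[/in_IP[b [lt_b _ ->]]].
rewrite off_leq ?off_ltn; try lia.
move=> /andP[le_tb lt_bu]; have E : b = a + (b - a) by lia.
by rewrite E half_run; [apply: cond; lia | lia].
Qed.

Lemma next_J_run : next_J nu (off a) = off (a + r).
Proof.
rewrite /next_J; apply: bigmin_eq.
- rewrite mem_index_iota off_lt ?ltnS; last by lia.
  by rewrite -off_size off_leq.
- move: le_r; rewrite leq_eqVlt => /predU1P[->|lt_r];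
  first by rewrite off_size eqxx orbT.
  by rewrite in_J_off // run_end.
- move=> u; rewrite mem_index_iota =>
  /andP[lt_u _] /orP[/in_JP[b [lt_b nsec_b eq_u]]|/eqP->].
    have lt_ab : a < b by rewrite -off_ltn -?eq_u //; lia.
    rewrite eq_u off_leq //; last by rewrite ltnW.
    rewrite leqNgt; apply: contra nsec_b => lt_br.
    by rewrite -(subnKC (ltnW lt_ab)) run //; lia.
  by rewrite -off_size off_leq.
- by rewrite -off_size off_leq.
Qed.

Lemma bridge_setP i : reflect (exists2 u, 0 < u < r &
    i = off (a + u) /\ bridge_cond nu (off a) (off (a + u)))
  (i \in bridge_set nu (off a)).
Proof.
rewrite mem_filter mem_index_iota next_J_run.
apply: (iffP andP) => [[/andP[/in_IP[b [lt_b _ ->]] cond]] | [u /andP[u_gt0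
  lt_ur] [-> cond]]].
  rewrite !off_ltn; try lia.
  move=> /andP[lt_ab lt_br]; have E : b = a + (b - a) by lia.
  by exists (b - a); [lia | rewrite -E].
by rewrite cond in_I_off ?run ?off_ltn //; lia.
Qed.

Lemma head_at u : u <= r -> a + u < size nu ->
  exists2 y, h (a + u) = Some y & succeq y (eterm nu (off (a + u))).
Proof.
move=> le_u lt_au; case: (ltnP u r) => [lt_u | ge_u]; last first.
  have E : u = r by lia.
  rewrite h_primary //; last by rewrite E run_end // -E.
  by eexists; first by []; rewrite /succeq eqxx orbT.
rewrite h_sec ?run //; eexists; first by [].
case E : (h (a + u).+1) => [y|]; last by rewrite /succeq eqxx orbT.
case: ifPn => [_|]; first by rewrite /succeq eqxx orbT.
have := run lt_u; rewrite /sec_at; case Ea: (nu_ (a + u)) => [k [//|q]] _.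
rewrite (eterm_upper lt_au Ea) (eterm_lower lt_au Ea).
exact: crossed_upper (h_prim E).
Qed.

(** Each passage adds one to the term at [v]. The result is only a bound because a term from further
    right may have come in front of it. *)
Lemma dominated t v : t < v -> v <= r -> a + v < size nu ->
    (forall s, t < s < v -> crosses s v) ->
  exists2 y, h (a + t).+1 = Some y &
    succeq y (shift (eterm nu (off (a + v))) ((v - t)%:Z - 1)%R).
Proof.
move=> + le_v lt_v; have [d] := ubnP (v - t);
  elim: d t => // d IHd t lt_d lt_tv cr.
rewrite -addnS; case: (ltngtP t.+1 v) lt_tv => // [lt_t1 _|eq_v _].
  have [||s|y eq_h yv] := IHd t.+1; try lia.
    by move=> ?; apply: cr; lia.
  have lt_at : a + t.+1 < size nu by lia.
  have cr1 : crosses t.+1 v by apply: cr; lia.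
  rewrite h_sec ?run ?(leq_trans lt_t1) // eq_h.
  rewrite ifN; last by apply: contra cr1 => /succ_succeq_trans; apply.
  exists (shift y 1) => //.
  suff -> : ((v - t)%:Z - 1 = (v - t.+1)%:Z - 1 + 1)%R by rewrite -shiftA
    succeq_shift.
  by lia.
have -> : ((v - t)%:Z - 1 = 0)%R by lia.
by rewrite shift0 eq_v; apply: head_at.
Qed.

(** Follows the head of the unwound tail back to the term it comes from. The last clause says that
    nothing passes the secondary part at [v], which makes [v] maximal. *)
Lemma origin_head t y : t < r -> h (a + t).+1 = Some y ->
  exists v, [/\ t < v <= r, a + v < size nu,
    y = shift (eterm nu (off (a + v))) ((v - t)%:Z - 1)%R,
    forall s, t < s < v -> crosses s v &
    v < r -> forall z, h (a + v).+1 = Some z ->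
      succ (eterm nu (off (a + v)).+1) z].
Proof.
have [d] := ubnP (r - t); elim: d t y => // d IHd t y lt_d lt_tr.
rewrite -addnS => eq_h.
have lt_at : a + t.+1 < size nu by rewrite ltnNge; apply/negP => /h_none;
  rewrite eq_h.
have one : ((t.+1 - t)%:Z - 1 = 0)%R by lia.
case: (ltnP t.+1 r) => [lt_t1|ge_t1]; last first.
  have E : t.+1 = r by lia.
  exists t.+1; split=> //; try lia.
    rewrite one shift0; move: eq_h; rewrite h_primary // => [[<-] //|].
    by rewrite E run_end // -E.
have sec_at := run lt_t1.
have stop : y = eterm nu (off (a + t.+1)) ->
  (forall z, h (a + t.+1).+1 = Some z ->
    succ (eterm nu (off (a + t.+1)).+1) z) ->
  exists v, [/\ t < v <= r, a + v < size nu,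
    y = shift (eterm nu (off (a + v))) ((v - t)%:Z - 1)%R,
    forall s, t < s < v -> crosses s v &
    v < r -> forall z, h (a + v).+1 = Some z ->
      succ (eterm nu (off (a + v)).+1) z].
  by move=> -> stop; exists t.+1; split=> //; [lia | rewrite one shift0 | lia].
move: eq_h stop; rewrite h_sec //; case E: (h (a + t.+1).+1) => [z|] [<-];
  last by apply.
case: ifPn => [lo_z|cross _]; first by apply=> // ? [<-].
have [||v [tv lt_v eq_z cr st]] := IHd t.+1 z _ _ E; try lia.
exists v; split=> //; first lia.
  by rewrite eq_z shiftA; congr shift; lia.
move=> s /andP[]; rewrite leq_eqVlt => /predU1P[<- _|lt_ts lt_sv];
  last by apply: cr; lia.
by rewrite /crosses -eq_z.
Qed.

(** The conventional final term has size 0, while the lower half of a secondary part of E has size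
    at least 1; hence that term passes nothing and no bridge leads to it. *)
Lemma bridge_real : (forall t, t < r -> crosses t r) -> a + r < size nu.
Proof.
move=> cr; have lt_r1 : a + r.-1 < size nu by lia.
have := cr r.-1; rewrite ltn_predL => /(_ r_gt0).
rewrite ltnNge; apply: contra => ge_r.
have -> : eterm nu (off (a + r)) = last_part n.
  have -> : a + r = size nu by lia.
  by rewrite off_size /eterm nth_default.
have -> : ((r - r.-1)%:Z - 1 = 0)%R by lia.
rewrite shift0; have := @run r.-1; rewrite ltn_predL => /(_ r_gt0).
rewrite /sec_at; case E: (nu_ (a + r.-1)) => [k [//|q]] _.
rewrite (eterm_lower lt_r1 E).
have := allP (proj1 (andP nuE)) _ (mem_nth (last_part n) lt_r1).
by rewrite /= -/(nu_ _) E succE; case/orP=> /andP[] //= _;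
  name_halves k q => /=; lia.
Qed.

(** If [u] passed everything before it, the head behind [v] would be at least its term on arrival at
    [v]; the lower half at [v] is above that head, so it is not passed. *)
Lemma stopped_max v : 0 < v < r ->
  (forall z, h (a + v).+1 = Some z -> succ (eterm nu (off (a + v)).+1) z) ->
  forall u, v < u <= r -> a + u < size nu -> ~ (forall t, t < u -> crosses t u).
Proof.
move=> lt_v stop u lt_u lt_au cr.
have [||//|s ?|y eq_h yu] := @dominated v u; try lia; first by apply: cr; lia.
have /negP[] : crosses v u by apply: cr; lia.
by apply: succ_succeq_trans yu; apply: stop.
Qed.

Lemma Br_crossed y : h a.+1 = Some y -> ~~ succ (eterm nu (off a).+1) y ->
  exists2 v, 0 < v <= r & Br nu (off a) = off (a + v) /\
    shift y 1 = shift (eterm nu (off (a + v))) v%:Z.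
Proof.
move=> eq_h cross; have [|v] := @origin_head 0 y r_gt0; first by rewrite addn0.
case=> lt_v lt_av eq_y cr stop; exists v => //.
rewrite subn0 in eq_y; split; last by rewrite eq_y shiftA subrK.
have cr0 t : t < v -> crosses t v.
  case: t => [_|t lt_t]; last exact: cr.
  by rewrite /crosses subn0 -eq_y addn0.
have bc_v : bridge_cond nu (off a) (off (a + v)).
  rewrite -{1}[a]addn0; apply/bridge_condP; try lia.
  by move=> s /andP[_]; apply: cr0.
rewrite /Br next_J_run.
(* If [v] is the end of the run, the first branch of [Br] applies. Otherwise [stopped_max] rules out
   that branch and all later candidates, so [v] gives the maximum of [bridge_set]. *)
case: (ltnP v r) => [lt_vr|ge_vr]; last first.
  have E : v = r by lia.
  by move: bc_v; rewrite E => ->.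
have maxv u : v < u <= r -> ~~ bridge_cond nu (off a) (off (a + u)).
  move=> lt_u; apply/negP; rewrite -{1}[a]addn0 => /bridge_condP bc.
  have cru t : t < u -> crosses t u by move=> ?; apply: bc; lia.
  have lt_au : a + u < size nu.
    case: (ltngtP u r) lt_u => [||E] lt_u; try lia.
    by rewrite E; apply: bridge_real; rewrite -E.
  have v_r : 0 < v < r by lia.
  exact: stopped_max v_r (stop lt_vr) _ lt_u lt_au cru.
rewrite ifN; last by apply: maxv; lia.
have v_in : off (a + v) \in bridge_set nu (off a) by apply/bridge_setP;
  exists v; lia.
rewrite (_ : (if _ is [::] then _ else _) = \max_(u <- bridge_set nu (off a))
  u); last first.
  by case: (bridge_set _ _) v_in.
apply/eqP; rewrite eqn_leq (@leq_bigmax_seq _ _ xpredT id) // andbT.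
apply/bigmax_leqP_seq => _ /bridge_setP[u lt_u [-> bc]] _.
rewrite off_leq; [|lia|lia].
rewrite leq_add2l leqNgt; apply/negP => lt_vu.
have lt_vur : v < u <= r by lia.
by move: bc; apply/negP/maxv.
Qed.

(** By [dominated], a bridge target would bound the head of the tail from below and force it to
    pass. *)
Lemma Br_stopped : (forall y, h a.+1 = Some y ->
  succ (eterm nu (off a).+1) y) ->
  Br nu (off a) = off a.
Proof.
move=> stop.
have no_bc u : 0 < u <= r -> ~~ bridge_cond nu (off a) (off (a + u)).
  move=> lt_u; apply/negP; rewrite -{1}[a]addn0 => /bridge_condP bc.
  have cru t : t < u -> crosses t u by move=> ?; apply: bc; lia.
  have lt_au : a + u < size nu.
    case: (ltngtP u r) lt_u => [||E] lt_u; try lia.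
    by rewrite E; apply: bridge_real; rewrite -E.
  have [||//|s ?|y eq_h yu] := @dominated 0 u; try lia; first by apply: cru;
    lia.
  have /negP[] : crosses 0 u by apply: cru; lia.
  by rewrite addn0; apply: succ_succeq_trans yu; apply: stop; rewrite -[a]addn0.
rewrite /Br next_J_run ifN; last by apply: no_bc; lia.
case E: (bridge_set _ _) => [//|i s].
have /bridge_setP[u lt_u [_ bc]] : i \in bridge_set nu (off a) by rewrite E
  mem_head.
have lt_ur : 0 < u <= r by lia.
by case/negP: (no_bc u lt_ur).
Qed.

End Run.

Lemma sec_run a : a < size nu -> sec a -> exists r,
  [/\ 0 < r, a + r <= size nu, forall t, t < r -> sec (a + t) &
      a + r < size nu -> ~~ sec (a + r)].
Proof.
move=> lt_a sec_a.
have ex_r : exists r, (a + r == size nu) || ~~ sec (a + r).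
  by exists (size nu - a); rewrite subnKC ?eqxx // ltnW.
have [r r_end r_min] := ex_minnP ex_r; exists r.
have run t : t < r -> (a + t < size nu) && sec (a + t).
  elim: t => [|t IHt] lt_t; first by rewrite addn0 lt_a.
  have /andP[lt_at _] := IHt (ltnW lt_t).
  have : ~~ ((a + t.+1 == size nu) || ~~ sec (a + t.+1)).
    by apply/negP => /r_min; rewrite leqNgt lt_t.
  by rewrite negb_or negbK => /andP[neq ->]; rewrite andbT; lia.
split.
- by case: r r_end {r_min run} => //; rewrite addn0 sec_a orbF; lia.
- case: r r_end {r_min} run => [|r] _ run; first by rewrite addn0 ltnW.
  by have /andP[] := run r (ltnSn r); rewrite addnS.
- by move=> t /run/andP[].
- by case/orP: r_end => // /eqP->; rewrite ltnn.
Qed.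

Lemma size_sec a k q : a < size nu -> nu_ a = (k, inr q) -> (2 <= k)%R.
Proof.
move=> lt_a E; have := allP (proj1 (andP nuE)) _ (mem_nth (last_part n) lt_a).
by rewrite /= -/(nu_ a) E => /orP[] /andP[].
Qed.

Lemma gg_next a : a.+1 < size nu -> gg (nu_ a) (nu_ a.+1).
Proof. by move: nuE => /andP[_ /(sortedP (last_part n))]; apply. Qed.

(** Identifies the term compared in E_1 as [y + 1]; by [gg_sp], that comparison says that the
    secondary part is [gg] to [y]. *)
Lemma Br_head a y : a < size nu -> sec a -> h a.+1 = Some y ->
    ~~ succ (eterm nu (off a).+1) y ->
  off a < Br nu (off a) /\
  shift (eterm nu (Br nu (off a))) ((Br nu (off a) - off a)./2)%:Z = shift y 1.
Proof.
move=> lt_a sec_a eq_h cross;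
  have [r [r_gt0 le_r run run_end]] := sec_run lt_a sec_a.
have [v /andP[v_gt0 le_v] [->
  ->]] := Br_crossed r_gt0 le_r run run_end eq_h cross.
rewrite (off_run r_gt0 le_r run run_end le_v).
by rewrite addKn doubleK -addn1 leq_add2l double_gt0.
Qed.

Lemma Br_stay a : a < size nu -> sec a ->
  (forall y, h a.+1 = Some y -> succ (eterm nu (off a).+1) y) ->
    Br nu (off a) = off a.
Proof.
move=> lt_a sec_a; have [r [r_gt0 le_r run run_end]] := sec_run lt_a sec_a.
exact: (Br_stopped r_gt0 le_r run run_end).
Qed.

(* The rightmost violation [a] of [clear] is followed by a secondary part that
  is
   not [triangle]; moving left along the run, every element is again a
   violation, up to the first one, which is in TS. *)
Lemma in_E1P : in_E1 nu <-> clear nu.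
Proof.
split=> [[_ E1] | cl]; last first.
  split=> // i /and4P[/in_IP[a [lt_a sec_a ->]] _ _ _] lt_Br.
  rewrite opart_off //; move: (sec_a); rewrite /sec_at;
    case E: (nu_ a) => [k [//|q]] _.
  case eq_h: (h a.+1) => [y|]; last first.
    by rewrite Br_stay ?ltnn // in lt_Br => y; rewrite eq_h.
  have [cross|stop] := boolP (succ (eterm nu (off a).+1) y).
    by rewrite Br_stay ?ltnn // in lt_Br => z; rewrite eq_h => -[<-].
  have [_ ->] := Br_head lt_a sec_a eq_h stop; rewrite -gg_sp ?(h_prim eq_h) //.
  have := clearP (last_part n) nu cl a lt_a; rewrite -/(nu_ a) E => -[//|].
  by move: eq_h; rewrite /head_from; case: (unwind _) => //= z l [->].
have sec_split b : sec b -> exists k q, nu_ b = (k, inr q).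
  by rewrite /sec_at; case: (nu_ b) => k [//|q] _; exists k, q.
have not_stop a y : a.+1 < size nu -> sec a -> h a.+1 = Some y ->
    ~~ gg (nu_ a) y -> ~~ succ (eterm nu (off a).+1) y.
  move=> lt_a1 sec_a eq_h; have lt_a := ltnW lt_a1.
  have [k [q E]] := sec_split _ sec_a; rewrite (eterm_lower lt_a E) E.
  by apply: contra; apply: lower_lt_sec (h_prim eq_h) (size_sec lt_a E).
have no_TS a y : a.+1 < size nu -> sec a -> sec a.+1 ->
    ~~ triangle (nu_ a) (nu_ a.+1) -> h a.+1 = Some y -> ~~ gg (nu_ a) y ->
    ~~ (if a is b.+1 then triangle (nu_ b) (nu_ a) else true).
  move=> lt_a1 sec_a sec_a1 ntri eq_h ngg; apply/negP => tri;
    have lt_a := ltnW lt_a1.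
  have [lt_Br eq_Br] := Br_head lt_a sec_a eq_h (not_stop _ _ lt_a1 sec_a eq_h
    ngg).
  have off2 : (off a).+2 = off a.+1 by rewrite offS // sec_a addn2.
  have := E1 (off a); rewrite opart_off // eq_Br => E1_a.
  have [k [q E]] := sec_split _ sec_a; move: ngg;
    rewrite E gg_sp ?(h_prim eq_h) //.
  rewrite -E E1_a // /in_TS off2 !in_I_off // sec_a sec_a1 !opart_off // ntri
    /=.
  rewrite -[off a]addn0 origin_off //.
  by case: (a) tri => //= b tri; rewrite -/(nu_ _) tri.
have leftmost a y : a.+1 < size nu -> sec a -> sec a.+1 ->
    ~~ triangle (nu_ a) (nu_ a.+1) -> h a.+1 = Some y -> ~~ gg (nu_ a) y ->
      False.
  elim: a y => [|b IHb] y lt_a sec_a sec_a1 ntri eq_h ngg.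
    by case/negP: (no_TS _ _ lt_a sec_a sec_a1 ntri eq_h ngg).
  have [tri_b|ntri_b] := boolP (triangle (nu_ b) (nu_ b.+1)).
    by case/negP: (no_TS _ _ lt_a sec_a sec_a1 ntri eq_h ngg).
  (* When the part at [b] is primary, [gg] and [triangle] agree. *)
  have sec_b : sec b.
    apply: contraNT ntri_b => prim_b; have := gg_next (ltnW lt_a).
    by rewrite /triangle /gg; move: prim_b; rewrite /sec_at negbK => ->.
  have [k [q E]] := sec_split _ sec_a; have [k' [q' E']] := sec_split _ sec_b.
  apply: (IHb (shift y 1)) => //; [exact: ltnW | | rewrite E'].
    rewrite h_sec // 1?ltnW // eq_h ifN //; exact: not_stop lt_a sec_a eq_h ngg.
  by move: ntri_b ngg; rewrite E E'; apply: not_triangle_crossed (h_prim eq_h).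
apply/(clearP (last_part n)) => a; have [d] := ubnP (size nu - a).
elim: d a => // d IHd a lt_d lt_a; rewrite -/(nu_ a).
have [|sec_a] := boolP (is_primary (nu_ a).2); [by left | right].
apply: contraT; rewrite -/(sec a) in sec_a *;
  have [k [q E]] := sec_split _ sec_a.
case eq_u: (unwind _) => [//|y l] /= ngg.
have {l eq_u} eq_h : h a.+1 = Some y by rewrite /head_from eq_u.
have lt_a1 : a.+1 < size nu.
  by rewrite ltnNge; apply/negP => /h_none; rewrite eq_h.
have gg_a := gg_next lt_a1.
have sec_a1 : sec a.+1.
  apply: contraT => prim_a1; move: eq_h ngg; rewrite h_primary // => -[<-].
  by rewrite eterm_primary // gg_a.
(* It remains to exclude [triangle] at the rightmost violation. The head [y] is the next upper half,
   or [z + 1] with the next secondary part [gg] to [z] by induction; either way [a] would be no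
   violation. *)
case: (leftmost a y) => //; apply: contra ngg => tri_a.
have [k' [q' E']] := sec_split _ sec_a1; rewrite E E' in gg_a tri_a *.
move: eq_h; rewrite h_sec // (eterm_upper lt_a1 E') (eterm_lower lt_a1 E').
have up_gg := gg_sec_upper (size_sec lt_a1 E') gg_a.
case eq_h: (h a.+2) => [z|] [<-] //; case: ifP => // _.
apply: triangle_crossed (h_prim eq_h) tri_a _; rewrite -E'.
have [|||] := IHd a.+1; [lia | by [] | by rewrite -/(nu_ _) E' |].
by move: eq_h; rewrite /head_from; case: (unwind _) => //= ? ? [->].
Qed.

End Bridge.

(** * Counting and generating series *)

Section Counting.
Variable n : nat.
Implicit Types (C : {ffun 'I_n.+1 -> nat}) (m : nat).

Lemma O_set_image C m : O_set C m = (@unwind n.+1 @` E1_set C m)%classic.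
Proof.
apply/seteqP; split=> [s [sO sCm] | _ [nu [nuE1 nuCm] <-]].
  have [nu [nuE nu_cl eq_s]] := wind sO; exists nu => //; split.
    exact/(in_E1P nuE).
  by rewrite -unwind_monomial -unwind_weight eq_s.
have nuE := proj1 nuE1; split; last by rewrite unwind_monomial unwind_weight.
by have [] := unwindP nuE (proj1 (in_E1P nuE) nuE1).
Qed.

Lemma U_eq_W C m : U C m = W C m.
Proof.
have finE1 := finite_E1_set C m.
rewrite /U O_set_image fset_set_image // card_in_imfset // => nu nu'.
rewrite !in_fset_set // !inE => -[nuE1 _] [nuE1' _].
have [nuE nuE'] := (proj1 nuE1, proj1 nuE1').
by apply: unwind_inj => //; apply/in_E1P.
Qed.

End Counting.

(** * Monomials and truncated products of power series *)

Section Monomials.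
Variable I : finType.
Implicit Types (e d : {ffun I -> nat}) (f g : fps I).

Definition fps_mon d : fps I := fun e => (e == d)%:R.

Lemma fps_mon0 : fps_mon 0 = 1.
Proof. by []. Qed.

Lemma fps_monM d d' : fps_mon d * fps_mon d' = fps_mon (d + d').
Proof.
apply/funext=> e; rewrite [LHS](_ : _ = fps_mul (fps_mon d) (fps_mon d') e) //
  /fps_mul.
have eq0 c : c != d -> fps_mon d c * fps_mon d' (esub e c) = 0.
  by move=> /negPf cd; rewrite /fps_mon cd mul0r.
have [d_e | d_ne] := boolP (d \in below e).
  rewrite (bigD1_seq d) ?below_uniq //= [X in _ + X]big1 ?addr0 //.
  rewrite /fps_mon eqxx mul1r; congr (nat_of_bool _)%:R.
  move: d_e; rewrite mem_below => /forallP le_de.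
  apply/eqP/eqP => [<-|->]; apply/ffunP=> i; rewrite !ffunE /=.
    by rewrite [LHS](esym (subnKC (le_de i))).
  by rewrite addKn.
rewrite big_seq big1 => [|c c_e]; last by apply: eq0;
  apply: contraNneq d_ne => <-.
rewrite /fps_mon; case: eqP => // e_eq; case/negP: d_ne.
by rewrite mem_below; apply/forallP=> i; rewrite e_eq ffunE leq_addr.
Qed.

Lemma fps_mon_prod (J : Type) (s : seq J) (P : pred J) (F : J -> {ffun I ->
  nat}) :
  \prod_(j <- s | P j) fps_mon (F j) = fps_mon (\sum_(j <- s | P j) F j).
Proof. by rewrite (big_morph _ (fun d d' =>
  esym (fps_monM d d')) fps_mon0). Qed.

Lemma fps_varX (v : I) k : fps_var v ^+ k = fps_mon [ffun w =>
  (k * (w == v))%N].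
Proof.
elim: k => [|k IHk]; first by congr fps_mon; apply/ffunP=> w; rewrite !ffunE.
rewrite exprS IHk fps_monM; congr fps_mon; apply/ffunP=> w.
by rewrite !ffunE mulSn.
Qed.

Lemma coef_sum (J : finType) (P : pred J) (F : J -> fps I) e :
  (\sum_(j | P j) F j) e = \sum_(j | P j) F j e.
Proof. exact: (big_morph (fun f : fps I => f e)). Qed.

Lemma eq_coef_mul f f' g g' e :
  {in below e, f =1 f'} -> {in below e, g =1 g'} ->
    {in below e, f * g =1 f' * g'}.
Proof.
move=> eq_f eq_g d; rewrite mem_below => /forallP le_de.
rewrite [LHS]big_seq [RHS]big_seq; apply: eq_bigr => c.
rewrite mem_below => /forallP le_cd; rewrite eq_f ?eq_g // mem_below;
  apply/forallP=> i; last exact: leq_trans (le_de i).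
by rewrite ffunE (leq_trans (leq_subr _ _)).
Qed.

Lemma eq_coef_prod (J : Type) (s : seq J) (F G : J -> fps I) e :
  (forall j, {in below e, F j =1 G j}) ->
  {in below e, \prod_(j <- s) F j =1 \prod_(j <- s) G j}.
Proof.
move=> eqFG; elim: s => [|j s IHs]; first by rewrite !big_nil.
by rewrite !big_cons; apply: eq_coef_mul.
Qed.

End Monomials.

Lemma eventually_all (T : eqType) (s : seq T) (Q : nat -> T -> Prop) :
  (forall x, exists K, forall k, (K <= k)%N -> Q k x) ->
  exists K, forall k, (K <= k)%N -> {in s, forall x, Q k x}.
Proof.
move=> evQ; elim: s => [|x s [K sK]]; first by exists 0%N.
have [K' xK'] := evQ x; exists (maxn K K') => k;
  rewrite geq_max => /andP[le_K le_K'] y.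
by rewrite inE => /predU1P[->|/sK]; auto.
Qed.

(** A coefficient of a product depends only on the finitely many coefficients below it, so one
    truncation order serves all factors. *)
Lemma qpoch_prod_coef (I J : finType) (x : J -> fps I) (v : I) e :
  exists K, forall k, (K <= k)%N ->
    (\prod_j qpoch_infty (x j) (fps_var v)) e =
    (\prod_j \prod_(i < k) (1 - x j * fps_var v ^+ i)) e.
Proof.
pose Q k (d : {ffun I -> nat}) := forall j,
  qpoch_infty (x j) (fps_var v) d = (\prod_(i < k) (1 - x j * fps_var v ^+ i))
    d.
have [d|K allK] := @eventually_all _ (below e) Q.
  have [j|K jK] := @eventually_all _ (enum J) (fun k j =>
      qpoch_infty (x j) (fps_var v) d = (\prod_(i < k) (1 - x j * fps_var v ^+
        i)) d).
    by have [K jK] := qpoch_infty_cvg (x j) v d; exists K => k /jK.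
  by exists K => k le_k j; apply: jK; rewrite ?mem_enum.
exists K => k le_k.
have eq_coef := @eq_coef_prod I J (index_enum J) _ _ e (fun j d d_e =>
  allK k le_k d d_e j).
by apply: eq_coef; rewrite mem_below; apply/forallP.
Qed.

(** * Sequences of O as finite sets of pairs of a color and a size *)

Section Partitions.
Variables (n K : nat).
Implicit Types (p : 'I_n.+1 * 'I_K) (A : {set 'I_n.+1 * 'I_K}).

(** The ordinal starts from 0, so it stands for its successor as a size. *)
Definition part_of p : part n.+1 := ((p.2.+1)%:Z, inl p.1).

Definition exponent p : {ffun option 'I_n.+1 -> nat} :=
  [ffun w => if w is Some i then (p.1 == i : nat) else p.2.+1].

(** Sorting needs a total relation, hence the negated converse of [succ]; since the parts are
    distinct, the result is sorted by [succ] itself. *)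
Definition parts_of A : seq (part n.+1) :=
  sort (fun x y => ~~ succ y x) [seq part_of p | p <- enum A].

Lemma part_of_inj : injective part_of.
Proof. by move=> [i k] [j l] [/val_inj-> ->]. Qed.

Lemma mem_parts_of A p : (part_of p \in parts_of A) = (p \in A).
Proof. by rewrite mem_sort (mem_map part_of_inj) mem_enum. Qed.

Lemma parts_of_inj : injective parts_of.
Proof. by move=> A B eqAB; apply/setP=> p; rewrite -!mem_parts_of eqAB. Qed.

Lemma parts_of_O A : in_O (parts_of A).
Proof.
have prim : all (@in_P n.+1) (parts_of A).
  by apply/allP=> x; rewrite mem_sort => /mapP[p _ ->].
rewrite /in_O prim /=.
have : uniq (parts_of A) by rewrite sort_uniq (map_inj_uniq part_of_inj)
  enum_uniq.
have : sorted (fun x y => ~~ succ y x) (parts_of A).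
  apply: sort_sorted => x y; rewrite -negb_and; apply/negP=> /andP[yx xy].
  by have := succ_asym yx; rewrite xy.
elim: (parts_of A) prim => [|x [|y l] IHl] //= /and3P[x_P y_P l_P] /andP[xy yl]
  /andP[x_ne l_u].
move: IHl; rewrite /= y_P l_P => -> //; rewrite andbT; move: xy x_ne;
  rewrite inE negb_or => + /andP[+ _].
case: (x) (y) x_P y_P => kx [i|//] [ky [j|//]] _ _; rewrite xpair_eqE.
rewrite (_ : (inl i == inl j :> color n.+1) = (i == j :> nat)) //.
by rewrite !succ_pp; lia.
Qed.

Lemma big_parts_of (R : Type) (idx : R) (op : Monoid.com_law idx) (F : part
  n.+1 -> R) A :
  \big[op/idx]_(x <- parts_of A) F x = \big[op/idx]_(p in A) F (part_of p).
Proof.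
by rewrite (perm_big _ (permEl (perm_sort _ _))) big_map big_enum.
Qed.

Lemma parts_of_content A (e : {ffun option 'I_n.+1 -> nat}) :
  (monomial (parts_of A), weight (parts_of A)) =
    ([ffun i => e (Some i)], (e None)%:Z) <-> \sum_(p in A) exponent p = e.
Proof.
have eq_mon i : monomial (parts_of A) i = (\sum_(p in A) exponent p) (Some i).
  rewrite /monomial big_parts_of !sum_ffunE; apply: eq_bigr => p _.
  by rewrite !ffunE eq_sym.
have eq_weight : weight (parts_of A) = ((\sum_(p in A) exponent p)%R None)%:Z.
  rewrite /weight big_parts_of sum_ffunE (big_morph Posz PoszD (erefl _)).
  by apply: eq_bigr => p _; rewrite ffunE.
split=> [[eq_m eq_w] | <-]; last by congr pair; [apply/ffunP=> i;
  rewrite ffunE eq_mon | ].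
apply/ffunP=> -[i|]; first by rewrite -eq_mon eq_m ffunE.
by move: eq_w; rewrite eq_weight => -[].
Qed.

(** No part of a sequence of weight [m] is larger than [m], so the sizes up to [K] suffice. *)
Lemma O_set_parts C m : (m <= K)%N ->
  O_set C m = [set parts_of A | A in
    [set A | (monomial (parts_of A), weight (parts_of A)) = (C, m%:Z)]]%classic.
Proof.
move=> le_mK; apply/seteqP; split=> [s [sO sCm] | _ [A ACm <-]]; last first.
  by split; first exact: parts_of_O.
suff eq_s : parts_of [set p | part_of p \in s] = s.
  by exists [set p | part_of p \in s]%SET; rewrite /= ?eq_s.
have /andP[_ A_sorted] := parts_of_O [set p | part_of p \in s].
have /andP[s_P s_sorted] := sO.
apply: (irr_sorted_eq (@succ_trans _) (@succ_irr _)) => // x.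
apply/idP/idP => [|s_x].
  by rewrite mem_sort => /mapP[p]; rewrite mem_enum inE => ? ->.
have s_gt0 : all (fun x => 0 < x.1) s by apply: sub_all s_P => y /andP[].
have [|t eq_s] := @bounded_seq n m s s_gt0; first by case: sCm => _ ->.
have := s_x; rewrite {1}eq_s => /mapP[[k c] _ eq_x].
have x_P := allP s_P _ s_x; move: x_P s_x; rewrite {x}eq_x {t eq_s}.
case: c => [i|q] /=; last by case/andP.
case: k => -[|k] /= lt_k; first by case/andP.
have lt_kK : (k < K)%N by apply: leq_trans le_mK.
move=> _ s_x; rewrite -[X in X \in _]/(part_of (i, Ordinal lt_kK)).
by rewrite mem_parts_of inE.
Qed.

Lemma card_O_set C m : (m <= K)%N ->
  U C m = #|[pred A | (monomial (parts_of A), weight (parts_of A)) == (C,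
    m%:Z)]|.
Proof.
move=> le_mK; rewrite /U O_set_parts //.
set P := [pred A | _].
have -> : fset_set [set parts_of A | A in
    [set A | (monomial (parts_of A), weight (parts_of A)) = (C,
      m%:Z)]]%classic =
  [fset x in map parts_of (enum P)]%fset.
  apply/fsetP=> s; rewrite in_fset_set; last first.
    exact/finite_image/finite_finset.
  rewrite inE; apply/idP/mapP.
    by rewrite inE => -[A ACm <-]; exists A; rewrite // mem_enum inE; apply/eqP.
  by move=> [A + ->]; rewrite mem_enum !inE => /eqP ACm; exists A.
by rewrite card_fseq undup_id ?size_map ?cardE // map_inj_uniq ?enum_uniq //;
  apply: parts_of_inj.
Qed.

End Partitions.

Lemma gen_series_U (n : nat) : gen_series (@U n) =
  \prod_(i < n.+1) qpoch_infty (- var_a i * var_q n.+1) (var_q n.+1).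
Proof.
apply/funext=> e; rewrite /var_q.
have [K0 eqK] := qpoch_prod_coef (fun i : 'I_n.+1 =>
  - var_a i * fps_var None) None e.
(* Large enough both for the truncated products to have the right coefficient at [e] and for all
   parts of weight [e None] to be available. *)
pose K := maxn K0 (e None).
have factor (p : 'I_n.+1 * 'I_K) :
    1 - - var_a p.1 * fps_var None * fps_var None ^+ p.2 = fps_mon (exponent p)
      + 1.
  rewrite !mulNr opprK -mulrA -exprS fps_varX addrC.
  rewrite -[var_a _]expr1 fps_varX fps_monM; congr (fps_mon _ + 1).
  by apply/ffunP=> -[j|]; rewrite !ffunE ?muln0 ?muln1 ?addn0 ?mul1n //=
    [LHS]addn0 eq_sym.
rewrite (eqK K) ?leq_maxl // pair_big (eq_bigr _ (fun p _ => factor p)).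
(* Expanding the product, the set of factors in which the monomial is chosen is the set of parts of
   a sequence of O. *)
rewrite bigA_distr coef_sum /gen_series (@card_O_set n K) ?leq_maxr //
  -sum1_card.
rewrite (big_morph Posz PoszD (erefl _)) [LHS]big_mkcond;
  apply: eq_bigr => A _ /=.
rewrite -big_mkcond fps_mon_prod /fps_mon inE.
have [contentP Pcontent] := parts_of_content A e.
by case: eqP => [/contentP->|nc];
  [rewrite eqxx | case: eqP => // /esym/Pcontent].
Qed.

Theorem theorem1p4 (n : nat) :
  (forall (C : {ffun 'I_n.+1 -> nat}) (m : nat), U C m = W C m) /\
  gen_series (@W n) = gen_series (@U n) /\
  gen_series (@U n) =
    \prod_(i < n.+1) qpoch_infty (- var_a i * var_q n.+1) (var_q n.+1).
Proof.
split; first exact: U_eq_W.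
split; last exact: gen_series_U.
by apply/funext=> e; rewrite /gen_series U_eq_W.
Qed.
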